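(* Let $\gamma:S^1=\mathbb{R}/2\pi\mathbb{Z}\to\mathbb{R}^2$ be a non-co-orientable closed front with total absolute curvature $K(\gamma)=\pi$. Suppose that every singular point of $\gamma$ is a cusp. Then the number $N$ of cusps (i.e. the number of singular points of $\gamma$ in $S^1$) is an odd integer satisfying $N\ge 3$. Moreover, $N=3$ if and only if $\gamma$ is simple (i.e. injective on $S^1$).
   Context: A curve is a smooth ($C^\infty$) map $\gamma:I\to\mathbb{R}^2$ on a non-empty interval $I$ whose set of regular points ($\gamma'(t)\neq 0$) is dense in $I$; points with $\gamma'(t)=0$ are singular points. A curve $\gamma$ is a frontal if there is a smooth map $\boldsymbol{e}:I\to S^{1}\subset\mathbb{R}^2$ (unit circle) such that $\gamma'(t)$ and $\boldsymbol{e}(t)$ are linearly dependent for every $t\in I$; $\boldsymbol{e}$ is called a unit tangent vector field along $\gamma$ (unique up to a global sign). A frontal is a front (wave front) if $(\gamma,\boldsymbol{e}):I\to\mathbb{R}^2\times S^1$ is a regular curve (has nowhere vanishing derivative). A closed frontal (front) is a frontal (front) $\gamma:\mathbb{R}\to\mathbb{R}^2$ that is periodic, normalized to be $2\pi$-periodic, so its domain is regarded as $S^1=\mathbb{R}/2\pi\mathbb{Z}$. It is non-co-orientable if $\boldsymbol{e}(t+2\pi)=-\boldsymbol{e}(t)$ for all $t\in\mathbb{R}$. The total absolute curvature is $K(\gamma)=\int_{S^1}k\,ds=\int_0^{2\pi}\|\boldsymbol{e}'(t)\|\,dt$, where $k=\|\boldsymbol{e}'\|/\|\gamma'\|$ is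 the curvature function on the regular set and $ds=\|\gamma'\|\,dt$, so that $k\,ds=\|\boldsymbol{e}'(t)\|\,dt$ is continuous even at singular points. A singular point $c$ of $\gamma$ is a cusp if the map-germ of $\gamma$ at $c$ is right-left equivalent to the germ $t\mapsto(t^2,t^3)$ at $0$, i.e. becomes this germ after a local coordinate change of the parameter and a local diffeomorphism of $\mathbb{R}^2$. It is well known that this holds if and only if $\gamma'(c)=0$ and $\det(\gamma''(c),\gamma'''(c))\neq 0$. *)

(* Defs.v *)
From Stdlib Require Import Reals List Arith.
From Coquelicot Require Import Coquelicot.
Open Scope R_scope.

Definition enorm (v : R * R) : R := sqrt (fst v ^ 2 + snd v ^ 2).

Definition lin_dep (u v : R * R) : Prop :=
  exists a b : R, (a, b) <> (0, 0) /\
    a * fst u + b * fst v = 0 /\ a * snd u + b * snd v = 0.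

Definition smooth_on (U : R -> Prop) (f : R -> R) : Prop :=
  forall t, U t -> forall n, ex_derive_n f n t.

(* [ex_diff_n f n x y] asks that the partial derivatives of [f] of all orders
   [<= n] exist and be continuous at [(x, y)]. *)
Definition smooth_on2 (U : R * R -> Prop) (F : R * R -> R * R) : Prop :=
  forall p, U p -> forall n,
    ex_diff_n (fun x y => fst (F (x, y))) n (fst p) (snd p) /\
    ex_diff_n (fun x y => snd (F (x, y))) n (fst p) (snd p).

Definition smooth_path (g : R -> R * R) : Prop :=
  smooth_on (fun _ => True) (fun t => fst (g t)) /\
  smooth_on (fun _ => True) (fun t => snd (g t)).

Definition velocity (g : R -> R * R) (t : R) : R * R :=
  (Derive (fun s => fst (g s)) t, Derive (fun s => snd (g s)) t).

Definition singular (g : R -> R * R) (t : R) : Prop := velocity g t = (0, 0).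

Definition is_curve (g : R -> R * R) : Prop :=
  smooth_path g /\
  forall a b, a < b -> exists t, a < t < b /\ ~ singular g t.

Definition unit_tangent_field (g e : R -> R * R) : Prop :=
  smooth_path e /\
  (forall t, enorm (e t) = 1) /\
  (forall t, lin_dep (velocity g t) (e t)).

(* [e] is determined by [g] up to a global sign, so it is carried as an explicit
   argument; none of the notions below depends on that sign. *)
Definition is_front (g e : R -> R * R) : Prop :=
  is_curve g /\ unit_tangent_field g e /\
  forall t, ~ (velocity g t = (0, 0) /\ velocity e t = (0, 0)).

Definition is_closed_front (g e : R -> R * R) : Prop :=
  is_front g e /\ forall t, g (t + 2 * PI) = g t.

Definition non_co_orientable (e : R -> R * R) : Prop :=
  forall t, e (t + 2 * PI) = (- fst (e t), - snd (e t)).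

Definition total_absolute_curvature (e : R -> R * R) : R :=
  RInt (fun t => enorm (velocity e t)) 0 (2 * PI).

(* [f] restricts to a bijection between an open neighbourhood of [p] and an
   open set, smooth in both directions. *)
Definition local_diffeo {T : UniformSpace}
    (smooth : (T -> Prop) -> (T -> T) -> Prop) (f : T -> T) (p : T) : Prop :=
  exists (U V : T -> Prop) (h : T -> T),
    open U /\ open V /\ U p /\
    (forall x, U x -> V (f x) /\ h (f x) = x) /\
    (forall y, V y -> U (h y) /\ f (h y) = y) /\
    smooth U f /\ smooth V h.

Definition germ_equiv (g1 : R -> R * R) (c1 : R)
    (g2 : R -> R * R) (c2 : R) : Prop :=
  exists (phi : R -> R) (Phi : R * R -> R * R),
    local_diffeo smooth_on phi c2 /\ phi c2 = c1 /\
    local_diffeo smooth_on2 Phi (g1 c1) /\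
    locally c2 (fun t => Phi (g1 (phi t)) = g2 t).

Definition is_cusp (g : R -> R * R) (c : R) : Prop :=
  singular g c /\ germ_equiv g c (fun t => (t ^ 2, t ^ 3)) 0.

(* [0, 2 PI) represents the circle R / 2 PI Z. *)
Definition in_period (t : R) : Prop := 0 <= t < 2 * PI.

Definition has_card (A : R -> Prop) (N : nat) : Prop :=
  exists l : list R, NoDup l /\ length l = N /\ forall t, In t l <-> A t.

Definition simple_closed (g : R -> R * R) : Prop :=
  forall s t, in_period s -> in_period t -> g s = g t -> s = t.

(* Main.v *)
Require Import Defs.
From Stdlib Require Import Reals List Arith Lra Lia Sorted Classical ClassicalEpsilon.
From Coquelicot Require Import Coquelicot.
Open Scope R_scope.

(** Write the unit tangent field as [(cos th, sin th)] and the velocity of the curve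
    as [rho] times it.  Non-co-orientability makes [th] change by an odd multiple
    of [PI] over a period, while its total variation is the total absolute
    curvature [PI]; hence [th] is monotone, say nondecreasing, with
    [th (t + 2 PI) = th t + PI], and [rho] changes sign over a period
    ([front_half_turn]).  Singular points are the zeros of [rho].  A double zero
    would slow the curve down to [o(t^2)], which the cusp normal form
    [(t^2, t^3)] forbids, so the zeros are simple, hence finite in number in a
    period, and odd in number because [rho] is antiperiodic.

    Small numbers of cusps.  A subarc with at most one interior cusp cannot be a
    loop: without a cusp it advances in its mean direction, and with a single
    cusp [c] both [rho] and [sin (th - th c)] change sign at [c], so the height
    measured orthogonally to the cuspidal direction is strictly monotone
    ([loop_has_two_cusps]).  Applied to a whole period this excludes a single
    cusp.  If there are three cusps and two times with the same position, each of
    the two complementary loops would need two of them.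

    Five cusps or more.  Measure the height orthogonally to the direction of one
    cusp [c].  Its derivative is [rho] times [sin (th - th c)]; the sine vanishes
    exactly at [c] modulo the period, where [rho] vanishes too, so the height turns
    at all cusps other than [c] and nowhere else.  These [N - 1] turning points
    cut the closed curve into arcs, each a graph over an interval of heights.
    Consider an arc of least height extent and its two neighbours: over its
    range all three are graphs.  Since the front always turns the same way, both
    neighbours leave it on the same side.  If neither meets it again, then one
    neighbour is ahead of the other at the top and behind it at the bottom, and
    the two cross ([zigzag_crossing]).  As there are at least four arcs, the two
    times of the crossing differ by less than a period, so the curve is not
    simple. *)

(** * Real functions of one variable *)

Lemma ex_derive_continuity (f : R -> R) :
  (forall t, ex_derive f t) -> continuity f.
Proof.
  intros H t. apply continuity_pt_filterlim. apply (ex_derive_continuous f t (H t)).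
Qed.

Lemma derive_pos_incr (f df : R -> R) (a b : R) :
  a < b -> (forall t, is_derive f t (df t)) ->
  (forall t, a < t < b -> 0 < df t) -> f a < f b.
Proof.
  intros Hab Hd Hp.
  destruct (MVT_cor2 f df a b Hab) as (c & E & Hc).
  { intros c _. apply is_derive_Reals, Hd. }
  specialize (Hp c Hc). nra.
Qed.

Lemma derive_nonneg_incr (f df : R -> R) (a b : R) :
  a <= b -> (forall t, is_derive f t (df t)) ->
  (forall t, a < t < b -> 0 <= df t) -> f a <= f b.
Proof.
  intros [Hab | ->] Hd Hp; [ | lra].
  destruct (MVT_cor2 f df a b Hab) as (c & E & Hc).
  { intros c _. apply is_derive_Reals, Hd. }
  specialize (Hp c Hc). nra.
Qed.

Lemma is_derive_bound (f : R -> R) (c l : R) :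
  is_derive f c l -> forall eps, 0 < eps ->
  exists d, 0 < d /\
    forall t, Rabs (t - c) < d -> Rabs (f t - f c - l * (t - c)) <= eps * Rabs (t - c).
Proof.
  intros H eps He. apply is_derive_Reals in H.
  destruct (H eps He) as (d & Hd). exists d; split; [apply cond_pos | ].
  intros t Ht. destruct (Req_dec t c) as [-> | Hn].
  - rewrite !Rminus_diag, Rmult_0_r, Rminus_0_r, Rabs_R0. lra.
  - assert (Hh : t - c <> 0) by lra.
    specialize (Hd (t - c) Hh Ht). replace (c + (t - c)) with t in Hd by ring.
    replace (f t - f c - l * (t - c)) with (((f t - f c) / (t - c) - l) * (t - c))
      by (field; exact Hh).
    rewrite Rabs_mult. apply Rmult_le_compat_r; [apply Rabs_pos | lra].
Qed.

Lemma is_derive_pos_local (f : R -> R) (c l : R) :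
  is_derive f c l -> 0 < l ->
  exists d, 0 < d /\ (forall t, c < t < c + d -> f c < f t) /\
    (forall t, c - d < t < c -> f t < f c).
Proof.
  intros H Hl. destruct (is_derive_bound f c l H (l / 2)) as (d & Hd & B); [lra | ].
  exists d; split; [exact Hd | split]; intros t Ht.
  - specialize (B t). rewrite (Rabs_pos_eq (t - c)) in B by lra.
    specialize (B ltac:(lra)).
    destruct (Rabs_le_between (f t - f c - l * (t - c)) (l / 2 * (t - c))) as [K _].
    specialize (K B). nra.
  - specialize (B t). rewrite (Rabs_left (t - c)) in B by lra.
    specialize (B ltac:(lra)).
    destruct (Rabs_le_between (f t - f c - l * (t - c)) (l / 2 * - (t - c))) as [K _].
    specialize (K B). nra.
Qed.

Lemma zero_free_sign (f : R -> R) (a b : R) :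
  continuity f -> (forall t, a < t < b -> f t <> 0) ->
  forall u v, a < u < b -> a < v < b -> 0 < f u * f v.
Proof.
  intros Hc Hz.
  assert (Hw : forall u v, a < u < b -> a < v < b -> u <= v -> 0 < f u * f v).
  { intros u v Hu Hv Huv. apply Rnot_le_lt. intros Hneg.
    destruct (IVT_cor f u v Hc Huv Hneg) as (z & Hz1 & Hz2).
    apply (Hz z); [lra | exact Hz2]. }
  intros u v Hu Hv. destruct (Rle_dec u v) as [L | L].
  - apply Hw; assumption.
  - rewrite Rmult_comm. apply Hw; [assumption .. | lra].
Qed.

Lemma real_induction (S : R -> Prop) (a b : R) :
  a <= b -> S a ->
  (forall t, a <= t <= b -> exists d, 0 < d /\
    forall u v, a <= u -> t - d < u <= v -> v < t + d -> S u -> S v) ->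
  S b.
Proof.
  intros Hab Sa Hstep.
  destruct (completeness (fun t => a <= t <= b /\ S t)) as (m & Hub & Hlub).
  - exists b. intros t Ht; lra.
  - exists a. split; [lra | exact Sa].
  - assert (Ham : a <= m) by (apply Hub; split; [lra | exact Sa]).
    assert (Hmb : m <= b) by (apply Hlub; intros t Ht; lra).
    destruct (Hstep m (conj Ham Hmb)) as (d & Hd & Hs).
    destruct (classic (exists u, a <= u <= b /\ S u /\ m - d < u)) as [(u & Hu & Su & Hdu) | Hno].
    + assert (Hum : u <= m) by (apply Hub; split; assumption).
      destruct (Rlt_dec m b) as [L | L].
      * exfalso. set (v := Rmin b (m + d / 2)).
        assert (Hv : m < v <= b /\ v < m + d).
        { unfold v. split; [split | ].
          - apply Rmin_glb_lt; lra.
          - apply Rmin_l.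
          - apply Rle_lt_trans with (1 := Rmin_r _ _). lra. }
        assert (v <= m); [ | lra].
        apply Hub. split; [lra | ]. apply (Hs u v); [lra .. | exact Su].
      * replace b with m by lra. apply (Hs u m); [lra .. | exact Su].
    + exfalso. assert (m <= m - d); [ | lra].
      apply Hlub. intros t [Ht St]. apply Rnot_lt_le. intros Hlt.
      apply Hno. exists t. auto.
Qed.

Lemma is_derive_lincomb (f g : R -> R) (t df dg a b : R) :
  is_derive f t df -> is_derive g t dg ->
  is_derive (fun u => a * f u + b * g u) t (a * df + b * dg).
Proof.
  intros Hf Hg. apply (is_derive_plus (fun u => a * f u) (fun u => b * g u)).
  - now apply is_derive_scal.
  - now apply is_derive_scal.
Qed.

Lemma constant_sign (f : R -> R) (u v : R) :
  continuity f -> u < v -> (forall t, u < t < v -> f t <> 0) ->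
  exists k, (k = 1 \/ k = -1) /\ forall t, u < t < v -> 0 < k * f t.
Proof.
  intros Hc Huv Hz. set (m := (u + v) / 2).
  assert (Hm : u < m < v) by (unfold m; lra).
  pose proof (Hz m Hm).
  destruct (Rlt_dec 0 (f m)) as [L | L]; [exists 1 | exists (-1)]; (split; [auto | ]);
    intros t Ht; pose proof (zero_free_sign f u v Hc Hz m t Hm Ht); nra.
Qed.

(** * Simple zeros *)

Definition simple_zeros (f : R -> R) : Prop :=
  forall t, f t = 0 -> Derive f t <> 0.

Lemma simple_zero_sign (f : R -> R) (c : R) :
  ex_derive f c -> f c = 0 -> Derive f c <> 0 ->
  exists d, 0 < d /\ (forall t, c < t < c + d -> 0 < f t * Derive f c) /\
    (forall t, c - d < t < c -> f t * Derive f c < 0).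
Proof.
  intros He Hz Hd.
  destruct (is_derive_pos_local (fun t => f t * Derive f c) c (Derive f c * Derive f c))
    as (d & Hpos & Hr & Hl).
  - apply Derive_correct in He. auto_derive; [exists (Derive f c); exact He | ].
    change (Derive (fun x => f x) c) with (Derive f c). ring.
  - nra.
  - exists d. split; [exact Hpos | ]. rewrite Hz, Rmult_0_l in Hr, Hl. auto.
Qed.

Lemma simple_zeros_isolated (f : R -> R) (t : R) :
  (forall s, ex_derive f s) -> simple_zeros f ->
  exists d, 0 < d /\ forall s, t - d < s < t + d -> f s = 0 -> s = t.
Proof.
  intros He Hs. destruct (Req_dec (f t) 0) as [Z | NZ].
  - destruct (simple_zero_sign f t (He t) Z (Hs t Z)) as (d & Hd & Hr & Hl).
    exists d; split; [exact Hd | ]. intros s Hst Zs.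
    destruct (Rtotal_order s t) as [L | [E | G]]; [ | exact E | ].
    + specialize (Hl s ltac:(lra)). nra.
    + specialize (Hr s ltac:(lra)). nra.
  - pose proof (ex_derive_continuity f He t) as Hc.
    destruct (Hc (Rabs (f t))) as (d & Hd & B).
    { apply Rabs_pos_lt, NZ. }
    exists d; split; [exact Hd | ]. intros s Hst Zs.
    destruct (Req_dec s t) as [E | NE]; [exact E | exfalso].
    specialize (B s). simpl in B. unfold R_dist in B.
    rewrite Zs, Rminus_0_l, Rabs_Ropp in B.
    apply (Rlt_irrefl (Rabs (f t))), B.
    split; [split; [exact I | auto] | ].
    apply Rabs_def1; lra.
Qed.

Lemma single_zero_sign (f : R -> R) (s c t : R) :
  (forall u, ex_derive f u) -> s < c < t -> f c = 0 -> Derive f c <> 0 ->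
  (forall u, s < u < t -> f u = 0 -> u = c) ->
  (forall u, c < u < t -> 0 < Derive f c * f u) /\
  (forall u, s < u < c -> Derive f c * f u < 0).
Proof.
  intros He Hc Z Hd Hu.
  pose proof (ex_derive_continuity f He) as Hcont.
  destruct (simple_zero_sign f c (He c) Z Hd) as (d & Hd0 & Hr & Hl).
  split; intros u Hcu.
  - set (v := Rmin u (c + d / 2)).
    assert (Hv : c < v <= u /\ v < c + d).
    { unfold v. split; [split; [apply Rmin_glb_lt; lra | apply Rmin_l] | ].
      pose proof (Rmin_r u (c + d / 2)). lra. }
    specialize (Hr v ltac:(lra)).
    assert (0 < f u * f v).
    { apply (zero_free_sign f c t Hcont); [ | lra | lra].
      intros w Hw Zw. apply Hu in Zw; lra. }
    nra.
  - set (v := Rmax u (c - d / 2)).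
    assert (Hv : u <= v < c /\ c - d < v).
    { unfold v. split; [split; [apply Rmax_l | apply Rmax_lub_lt; lra] | ].
      pose proof (Rmax_r u (c - d / 2)). lra. }
    specialize (Hl v ltac:(lra)).
    assert (0 < f u * f v).
    { apply (zero_free_sign f s c Hcont); [ | lra | lra].
      intros w Hw Zw. apply Hu in Zw; lra. }
    nra.
Qed.

Lemma simple_zeros_finite (f : R -> R) (a b : R) :
  (forall s, ex_derive f s) -> simple_zeros f -> a <= b ->
  exists l, StronglySorted Rlt l /\ forall t, In t l <-> (a <= t < b /\ f t = 0).
Proof.
  intros He Hs Hab.
  apply (real_induction (fun b => exists l, StronglySorted Rlt l /\
    forall t, In t l <-> (a <= t < b /\ f t = 0)) a b Hab).
  - exists nil. split; [constructor | ]. simpl. intros t. split; [tauto | lra].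
  - intros t _. destruct (simple_zeros_isolated f t He Hs) as (d & Hd & Hi).
    exists d; split; [exact Hd | ]. intros u v Hau Huv Hv (l & Hl & Hin).
    destruct (classic (u <= t < v /\ f t = 0)) as [(Ht & Z) | NZ].
    + exists (l ++ t :: nil). split.
      * assert (Hlt : forall s, In s l -> s < t) by (intros s Hsl; apply Hin in Hsl; lra).
        clear Hin. induction Hl as [ | x l Hl IH Hx].
        -- constructor; constructor.
        -- simpl. constructor.
           ++ apply IH. intros s Hsl. apply Hlt. now right.
           ++ apply Forall_app. split; [exact Hx | ].
              constructor; [apply Hlt; now left | constructor].
      * intros s. rewrite in_app_iff, Hin. simpl. split.
        -- intros [(A & B) | [<- | []]]; split; auto; lra.
        -- intros (A & B). destruct (Rlt_dec s u) as [L | L].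
           ++ left. split; [lra | exact B].
           ++ right. left. symmetry. apply Hi; [lra | exact B].
    + exists l. split; [exact Hl | ]. intros s. rewrite Hin.
      split; intros (A & B); (split; [ | exact B]); [lra | ].
      split; [lra | ]. apply Rnot_le_lt. intros Hus. apply NZ.
      assert (s = t) by (apply Hi; [lra | exact B]). subst s. split; [lra | exact B].
Qed.

(** Each simple zero reverses the sign, so the parity is read off at the ends. *)
Lemma simple_zeros_parity (f : R -> R) (l : list R) :
  (forall s, ex_derive f s) -> simple_zeros f -> StronglySorted Rlt l ->
  forall a b, a < b -> f a <> 0 -> f b <> 0 ->
  (forall t, In t l <-> (a < t < b /\ f t = 0)) ->
  (Nat.Even (length l) <-> 0 < f a * f b).
Proof.
  intros He Hs Hl.
  pose proof (ex_derive_continuity f He) as Hc.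
  induction Hl as [ | c l Hl IH Hlt]; intros a b Hab Ha Hb Hin.
  - split; [intros _ | intros _; exists 0%nat; reflexivity].
    apply Rnot_le_lt. intros Hneg.
    destruct (IVT_cor f a b Hc (Rlt_le _ _ Hab) Hneg) as (z & Hz & Z).
    assert (z <> a) by congruence. assert (z <> b) by congruence.
    apply (proj2 (Hin z)). split; [lra | exact Z].
  - rewrite Forall_forall in Hlt.
    destruct (proj1 (Hin c) (or_introl eq_refl)) as [Hc1 Zc].
    destruct (simple_zero_sign f c (He c) Zc (Hs c Zc)) as (d & Hd & Hr & Hle).
    destruct (simple_zeros_isolated f c He Hs) as (d' & Hd' & Hi).
    set (m := Rmin (Rmin d d') (Rmin (c - a) (b - c))).
    assert (Hm : 0 < m) by (unfold m; repeat apply Rmin_glb_lt; lra).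
    assert (m <= d /\ m <= d' /\ m <= c - a /\ m <= b - c) as (M1 & M2 & M3 & M4).
    { unfold m. repeat split.
      - eapply Rle_trans; [apply Rmin_l | apply Rmin_l].
      - eapply Rle_trans; [apply Rmin_l | apply Rmin_r].
      - eapply Rle_trans; [apply Rmin_r | apply Rmin_l].
      - eapply Rle_trans; [apply Rmin_r | apply Rmin_r]. }
    set (v := c + m / 2). set (u := c - m / 2).
    specialize (Hr v ltac:(unfold v; lra)). specialize (Hle u ltac:(unfold u; lra)).
    assert (Hau : 0 < f a * f u).
    { apply Rnot_le_lt. intros Hneg.
      destruct (IVT_cor f a u Hc) as (z & Hz & Z); [unfold u; lra | exact Hneg | ].
      assert (z <> a) by congruence.
      assert (Hzl : In z (c :: l)) by (apply Hin; unfold u in Hz; split; [lra | exact Z]).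
      destruct Hzl as [<- | Hzl]; [unfold u in Hz; lra | ].
      apply Hlt in Hzl. unfold u in Hz. lra. }
    specialize (IH v b ltac:(unfold v; lra) ltac:(nra) Hb).
    assert (Hev : Nat.Even (length l) <-> 0 < f v * f b).
    { apply IH. intros t. split.
      - intros Ht. destruct (proj1 (Hin t) (or_intror Ht)) as (A & Z).
        split; [ | exact Z]. split; [ | lra]. apply Rnot_le_lt. intros Htv.
        apply Hlt in Ht. assert (t = c); [ | lra].
        apply Hi; [unfold v in Htv; lra | exact Z].
      - intros (A & Z). destruct (proj2 (Hin t)) as [E | Ht];
          [split; [unfold v in A; lra | exact Z] | unfold v in A; lra | exact Ht]. }
    assert (Hneg : f a * f v < 0) by (assert (f u * f v < 0) by nra; nra).
    simpl. rewrite Nat.Even_succ. split.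
    + intros Hodd. apply Rnot_le_lt. intros Hn.
      apply (Nat.Even_Odd_False (length l)); [ | exact Hodd].
      apply Hev. assert (f a * f b <> 0) by (intros E; apply Rmult_integral in E; tauto). nra.
    + intros Hp. destruct (Nat.Even_or_Odd (length l)) as [E | O]; [ | exact O].
      exfalso. apply Hev in E. nra.
Qed.

(** * Crossing of monotone arcs *)

Definition incr_on (f : R -> R) (a b : R) : Prop :=
  forall u v, a <= u -> u < v -> v <= b -> f u < f v.

Definition decr_on (f : R -> R) (a b : R) : Prop := incr_on (fun t => - f t) a b.

Lemma incr_on_join (f : R -> R) (a b c : R) :
  a <= b <= c -> incr_on f a b -> incr_on f b c -> incr_on f a c.
Proof.
  intros Hab H1 H2 u v Hu Huv Hv.
  destruct (Rle_dec v b) as [L | L]; [apply H1; lra | ].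
  destruct (Rle_dec b u) as [L' | L']; [apply H2; lra | ].
  apply Rlt_trans with (f b); [apply H1; lra | apply H2; lra].
Qed.

Lemma incr_on_shift (f : R -> R) (T a b : R) :
  (forall t, f (t + T) = f t) -> incr_on f a b -> incr_on f (a + T) (b + T).
Proof.
  intros Hp H u v Hu Huv Hv.
  replace u with (u - T + T) by ring. replace v with (v - T + T) by ring.
  rewrite !Hp. apply H; lra.
Qed.

Lemma incr_homeo_inverse (f : R -> R) :
  continuity f -> (forall u v, u < v -> f u < f v) ->
  (forall y, exists u v, f u <= y <= f v) ->
  exists g, continuity g /\ (forall y, f (g y) = y).
Proof.
  intros Hc Hi Hs.
  assert (Hex : forall y, exists t, f t = y).
  { intros y. destruct (Hs y) as (u & v & Hu & Hv).
    destruct (IVT_gen f u v y Hc) as (t & _ & E); [ | exists t; exact E].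
    split; [apply Rle_trans with (1 := Rmin_l _ _), Hu | ].
    apply Rle_trans with (2 := Rmax_r _ _), Hv. }
  assert (Hinv : exists g, forall y, f (g y) = y).
  { exists (fun y => proj1_sig (constructive_indefinite_description _ (Hex y))).
    intros y. apply proj2_sig. }
  destruct Hinv as (g & Hg). exists g. split; [ | exact Hg].
  assert (Hrefl : forall u v, f u < f v -> u < v).
  { intros u v H. apply Rnot_le_lt. intros [L | ->]; [apply Hi in L | ]; lra. }
  intros y eps He.
  exists (Rmin (f (g y + eps) - y) (y - f (g y - eps))). split.
  - apply Rmin_glb_lt.
    + assert (f (g y) < f (g y + eps)) by (apply Hi; lra). rewrite Hg in H. lra.
    + assert (f (g y - eps) < f (g y)) by (apply Hi; lra). rewrite Hg in H. lra.
  - intros x [_ Hx]. simpl in *. unfold R_dist in *.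
    assert (H1 : Rabs (x - y) < f (g y + eps) - y)
      by (eapply Rlt_le_trans; [exact Hx | apply Rmin_l]).
    assert (H2 : Rabs (x - y) < y - f (g y - eps))
      by (eapply Rlt_le_trans; [exact Hx | apply Rmin_r]).
    apply Rabs_def2 in H1. apply Rabs_def2 in H2.
    assert (g x < g y + eps) by (apply Hrefl; rewrite Hg; lra).
    assert (g y - eps < g x) by (apply Hrefl; rewrite Hg; lra).
    apply Rabs_def1; lra.
Qed.

(** Extending [f] with slope one outside the interval makes it a homeomorphism of
    the line, so that the inverse is continuous up to the ends of its range. *)
Lemma incr_on_inverse (f : R -> R) (a b : R) :
  a <= b -> continuity f -> incr_on f a b ->
  exists g, continuity g /\
    forall y, f a <= y <= f b -> a <= g y <= b /\ f (g y) = y.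
Proof.
  intros Hab Hc Hi.
  set (k := fun t => Rmax a (Rmin t b)).
  assert (Hk : forall t, (t < a /\ k t = a) \/ (a <= t <= b /\ k t = t) \/ (b < t /\ k t = b)).
  { intros t. unfold k, Rmax, Rmin.
    destruct (Rle_dec t b), (Rle_dec a _); lra. }
  assert (Hkc : continuity k).
  { intros t eps He. exists eps. split; [exact He | ]. intros s [_ Hs].
    simpl in *. unfold R_dist in *. apply Rle_lt_trans with (2 := Hs).
    destruct (Hk s) as [[? ->] | [[? ->] | [? ->]]], (Hk t) as [[? ->] | [[? ->] | [? ->]]];
      unfold Rabs;
      repeat match goal with |- context [Rcase_abs ?z] => destruct (Rcase_abs z) end; lra. }
  set (F := fun t => f (k t) + (t - k t)).
  assert (Hle : forall u v, a <= u -> u <= v -> v <= b -> f u <= f v).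
  { intros u v Hu [L | ->] Hv; [left; apply Hi; assumption | lra]. }
  destruct (incr_homeo_inverse F) as (g & Hgc & Hg).
  - unfold F. apply (continuity_plus (fun t => f (k t)) (fun t => t - k t)).
    + exact (continuity_comp k f Hkc Hc).
    + apply (continuity_minus (fun t => t) k); [ | exact Hkc].
      apply derivable_continuous, derivable_id.
  - intros u v Huv. unfold F.
    destruct (Hk u) as [[? ->] | [[? ->] | [? ->]]], (Hk v) as [[? ->] | [[? ->] | [? ->]]];
      try lra.
    + pose proof (Hle a v). lra.
    + pose proof (Hle a b). lra.
    + pose proof (Hi u v). lra.
    + pose proof (Hle u b). lra.
  - intros y. exists (a - Rabs (y - f a)), (b + Rabs (y - f b)).
    pose proof (Rle_abs (y - f b)). pose proof (Rle_abs (- (y - f a))) as H'.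
    rewrite Rabs_Ropp in H'.
    pose proof (Rabs_pos (y - f a)). pose proof (Rabs_pos (y - f b)).
    unfold F. split.
    + destruct (Hk (a - Rabs (y - f a))) as [[? ->] | [[? ->] | [? ->]]]; try lra.
      replace (a - Rabs (y - f a)) with a by lra. lra.
    + destruct (Hk (b + Rabs (y - f b))) as [[? ->] | [[? ->] | [? ->]]]; try lra.
      replace (b + Rabs (y - f b)) with b by lra. lra.
  - exists g. split; [exact Hgc | ]. intros y Hy. specialize (Hg y). unfold F in Hg.
    destruct (Hk (g y)) as [[? E] | [[? E] | [? E]]]; rewrite E in Hg; [lra | | lra].
    split; [assumption | lra].
Qed.

(** The turning points [q] and [r] cut the path into three graphs over the height
    [Y], and the heights of the middle one are attained on all three.  The outer
    graphs both start to the left of the middle one, the first at its top end and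
    the last at its bottom end.  Unless one of them meets the middle graph again,
    each stays to its left, so their order at the top is opposite to that at the
    bottom and they cross. *)
Lemma zigzag_crossing (X Y : R -> R) (p q r s d : R) :
  continuity X -> continuity Y -> p < q -> q < r -> r < s -> 0 < d ->
  incr_on Y p q -> decr_on Y q r -> incr_on Y r s ->
  Y p <= Y r -> Y q <= Y s ->
  (forall t t', q - d < t < q -> q < t' < q + d -> Y t = Y t' -> X t < X t') ->
  (forall t t', r - d < t < r -> r < t' < r + d -> Y t = Y t' -> X t' < X t) ->
  exists u v, p <= u /\ u < v /\ v <= s /\ X u = X v /\ Y u = Y v.
Proof.
  intros HX HY Hpq Hqr Hrs Hd I1 I2 I3 Hl Hh Wq Wr.
  destruct (incr_on_inverse Y p q) as (gP & cP & GP); [lra | assumption .. | ].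
  destruct (incr_on_inverse Y r s) as (gR & cR & GR); [lra | assumption .. | ].
  (* All three graphs are parametrized by the time [u] on the middle one. *)
  set (tP := fun u => gP (Y u)). set (tR := fun u => gR (Y u)).
  assert (D2 : forall u v, q <= u -> u < v -> v <= r -> Y v < Y u).
  { intros u v H1 H2 H3. specialize (I2 u v H1 H2 H3). lra. }
  assert (HYu : forall u, q <= u <= r -> Y r <= Y u <= Y q).
  { intros u Hu. split.
    - destruct (Req_dec u r) as [-> | N]; [lra | ]. left. apply D2; lra.
    - destruct (Req_dec u q) as [-> | N]; [lra | ]. left. apply D2; lra. }
  assert (TP : forall u, q <= u <= r -> p <= tP u <= q /\ Y (tP u) = Y u).
  { intros u Hu. apply GP. specialize (HYu u Hu). lra. }
  assert (TR : forall u, q <= u <= r -> r <= tR u <= s /\ Y (tR u) = Y u).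
  { intros u Hu. apply GR. specialize (HYu u Hu). lra. }
  assert (ctP : continuity tP) by exact (continuity_comp Y gP HY cP).
  assert (ctR : continuity tR) by exact (continuity_comp Y gR HY cR).
  assert (cXP : continuity (fun u => X (tP u))) by exact (continuity_comp tP X ctP HX).
  assert (cXR : continuity (fun u => X (tR u))) by exact (continuity_comp tR X ctR HX).
  assert (TPq : tP q = q).
  { destruct (TP q ltac:(lra)) as [A E]. destruct (Req_dec (tP q) q) as [-> | N]; [auto | ].
    specialize (I1 (tP q) q ltac:(lra) ltac:(lra) ltac:(lra)). lra. }
  assert (TRr : tR r = r).
  { destruct (TR r ltac:(lra)) as [A E]. destruct (Req_dec (tR r) r) as [-> | N]; [auto | ].
    specialize (I3 r (tR r) ltac:(lra) ltac:(lra) ltac:(lra)). lra. }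
  apply NNPP. intros Hno.
  assert (Hinj : forall u v, p <= u -> u < v -> v <= s -> Y u = Y v -> X u <> X v).
  { intros u v H1 H2 H3 H4 H5. apply Hno. exists u, v. auto. }
  assert (SP : forall u, q < u <= r -> X (tP u) < X u).
  { intros u Hu.
    destruct (ctP q d Hd) as (d1 & Hd1 & B).
    set (w := Rmin u (q + Rmin d d1 / 2)).
    assert (Rmin d d1 <= d /\ Rmin d d1 <= d1 /\ 0 < Rmin d d1) as (M1 & M2 & M3)
      by (repeat split; [apply Rmin_l | apply Rmin_r | apply Rmin_glb_lt; lra]).
    assert (Hw : q < w <= u /\ w < q + d /\ w < q + d1).
    { unfold w. split; [split; [apply Rmin_glb_lt; lra | apply Rmin_l] | ].
      pose proof (Rmin_r u (q + Rmin d d1 / 2)). lra. }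
    assert (Hsep : forall v, q < v <= r -> X (tP v) - X v <> 0).
    { intros v Hv E. destruct (TP v ltac:(lra)) as [A EY].
      apply (Hinj (tP v) v); lra. }
    assert (Hw0 : X (tP w) < X w).
    { destruct (TP w ltac:(lra)) as [A EY].
      apply Wq; [ | lra | exact EY].
      specialize (B w). simpl in B. unfold R_dist in B. rewrite TPq in B.
      assert (Hq : Rabs (tP w - q) < d).
      { apply B. split; [split; [exact I | lra] | ]. apply Rabs_def1; lra. }
      apply Rabs_def2 in Hq. split; [lra | ].
      destruct (Req_dec (tP w) q) as [E | N]; [ | lra].
      rewrite E in EY. specialize (D2 q w ltac:(lra) ltac:(lra) ltac:(lra)). lra. }
    apply Rnot_le_lt. intros Hge.
    destruct (IVT_cor (fun v => X (tP v) - X v) w u) as (z & Hz & Z).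
    - exact (continuity_minus (fun u => X (tP u)) X cXP HX).
    - lra.
    - simpl. nra.
    - apply (Hsep z); [lra | exact Z]. }
  assert (SR : forall u, q <= u < r -> X (tR u) < X u).
  { intros u Hu.
    destruct (ctR r d Hd) as (d1 & Hd1 & B).
    set (w := Rmax u (r - Rmin d d1 / 2)).
    assert (Rmin d d1 <= d /\ Rmin d d1 <= d1 /\ 0 < Rmin d d1) as (M1 & M2 & M3)
      by (repeat split; [apply Rmin_l | apply Rmin_r | apply Rmin_glb_lt; lra]).
    assert (Hw : u <= w < r /\ r - d < w /\ r - d1 < w).
    { unfold w. split; [split; [apply Rmax_l | apply Rmax_lub_lt; lra] | ].
      pose proof (Rmax_r u (r - Rmin d d1 / 2)). lra. }
    assert (Hsep : forall v, q <= v < r -> X (tR v) - X v <> 0).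
    { intros v Hv E. destruct (TR v ltac:(lra)) as [A EY].
      apply (Hinj v (tR v)); lra. }
    assert (Hw0 : X (tR w) < X w).
    { destruct (TR w ltac:(lra)) as [A EY].
      apply Wr; [lra | | symmetry; exact EY].
      specialize (B w). simpl in B. unfold R_dist in B. rewrite TRr in B.
      assert (Hq : Rabs (tR w - r) < d).
      { apply B. split; [split; [exact I | lra] | ]. apply Rabs_def1; lra. }
      apply Rabs_def2 in Hq. split; [ | lra].
      destruct (Req_dec (tR w) r) as [E | N]; [ | lra].
      rewrite E in EY. specialize (D2 w r ltac:(lra) ltac:(lra) ltac:(lra)). lra. }
    apply Rnot_le_lt. intros Hge.
    destruct (IVT_cor (fun v => X (tR v) - X v) u w) as (z & Hz & Z).
    - exact (continuity_minus (fun u => X (tR u)) X cXR HX).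
    - lra.
    - simpl. nra.
    - apply (Hsep z); [lra | exact Z]. }
  destruct (IVT_cor (fun v => X (tP v) - X (tR v)) q r) as (z & Hz & Z).
  - exact (continuity_minus _ _ cXP cXR).
  - lra.
  - cbv beta. rewrite TPq, TRr.
    specialize (SP r ltac:(lra)). specialize (SR q ltac:(lra)). nra.
  - destruct (TP z Hz) as [A EA], (TR z Hz) as [B EB].
    apply (Hinj (tP z) (tR z)); lra.
Qed.

(** * Fronts turning monotonically by a half turn *)

(** The planar fronts of the theorem in terms of the signed speed [rho] and the
    tangent angle [th], normalized to turn counterclockwise.  Cusps enter as
    simple zeros of [rho]; the front condition enters as strict growth of [th]
    on both sides of such a zero. *)
Record half_turn_front (x y rho th : R -> R) : Prop := {
  htf_x : forall t, is_derive x t (rho t * cos (th t));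
  htf_y : forall t, is_derive y t (rho t * sin (th t));
  htf_x_period : forall t, x (t + 2 * PI) = x t;
  htf_y_period : forall t, y (t + 2 * PI) = y t;
  htf_rho : forall t, ex_derive rho t;
  htf_rho_simple : simple_zeros rho;
  htf_rho_period : forall t, rho (t + 2 * PI) = - rho t;
  htf_th_cont : continuity th;
  htf_th_mono : forall s t, s <= t -> th s <= th t;
  htf_th_before : forall c t, rho c = 0 -> t < c -> th t < th c;
  htf_th_after : forall c t, rho c = 0 -> c < t -> th c < th t;
  htf_th_period : forall t, th (t + 2 * PI) = th t + PI
}.

Arguments htf_x {x y rho th}.
Arguments htf_y {x y rho th}.
Arguments htf_x_period {x y rho th}.
Arguments htf_y_period {x y rho th}.
Arguments htf_rho {x y rho th}.
Arguments htf_rho_simple {x y rho th}.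
Arguments htf_rho_period {x y rho th}.
Arguments htf_th_cont {x y rho th}.
Arguments htf_th_mono {x y rho th}.
Arguments htf_th_before {x y rho th}.
Arguments htf_th_after {x y rho th}.
Arguments htf_th_period {x y rho th}.

(** Coordinates in the frame rotated by the angle [a]. *)
Definition abscissa (x y : R -> R) (a t : R) : R := cos a * x t + sin a * y t.
Definition height (x y : R -> R) (a t : R) : R := cos a * y t - sin a * x t.

Lemma height_rotate (x y : R -> R) (a b t : R) :
  height x y b t = cos (b - a) * height x y a t - sin (b - a) * abscissa x y a t.
Proof.
  unfold height, abscissa. rewrite cos_minus, sin_minus.
  pose proof (sin2_cos2 a) as H. unfold Rsqr in H.
  replace (cos b * y t - sin b * x t)
    with ((sin a * sin a + cos a * cos a) * (cos b * y t - sin b * x t)) by (rewrite H; ring).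
  ring.
Qed.

Lemma abscissa_derive x y rho th (F : half_turn_front x y rho th) (a t : R) :
  is_derive (abscissa x y a) t (rho t * cos (th t - a)).
Proof.
  replace (rho t * cos (th t - a))
    with (cos a * (rho t * cos (th t)) + sin a * (rho t * sin (th t)))
    by (rewrite cos_minus; ring).
  apply is_derive_lincomb; [apply (htf_x F) | apply (htf_y F)].
Qed.

Lemma height_derive x y rho th (F : half_turn_front x y rho th) (a t : R) :
  is_derive (height x y a) t (rho t * sin (th t - a)).
Proof.
  replace (rho t * sin (th t - a))
    with (cos a * (rho t * sin (th t)) + - sin a * (rho t * cos (th t)))
    by (rewrite sin_minus; ring).
  apply is_derive_ext with (fun u => cos a * y u + - sin a * x u).
  { intros u. unfold height. simpl. ring. }
  apply is_derive_lincomb; [apply (htf_y F) | apply (htf_x F)].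
Qed.

Lemma htf_rho_cont x y rho th (F : half_turn_front x y rho th) : continuity rho.
Proof. apply ex_derive_continuity, (htf_rho F). Qed.

Lemma sin_pos_half_turn a : 0 < a < PI -> 0 < sin a.
Proof. intros H. apply sin_gt_0; lra. Qed.

(** Across a single cusp both the signed speed and the sine of the angle to the
    cuspidal direction change sign, so the height over that direction is
    strictly monotone. *)
Lemma height_across_cusp x y rho th (F : half_turn_front x y rho th) (s c t : R) :
  s < c < t -> t <= s + 2 * PI -> rho c = 0 ->
  (forall u, s < u < t -> rho u = 0 -> u = c) ->
  0 < Derive rho c * (height x y (th c) t - height x y (th c) s).
Proof.
  intros Hc Ht Z Hu.
  destruct (single_zero_sign rho s c t (htf_rho F) Hc Z (htf_rho_simple F c Z) Hu)
    as [Hr Hl].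
  assert (Htot : th t <= th s + PI).
  { rewrite <- (htf_th_period F s). apply (htf_th_mono F). lra. }
  set (G := fun u => Derive rho c * height x y (th c) u).
  assert (HG : forall u, is_derive G u (Derive rho c * (rho u * sin (th u - th c)))).
  { intros u. unfold G. apply (is_derive_scal (height x y (th c))), height_derive, F. }
  assert (G s < G c).
  { apply (derive_pos_incr G _ s c ltac:(lra) HG). intros u Hsu. cbv beta.
    specialize (Hl u Hsu).
    assert (th u < th c) by (apply (htf_th_before F); [exact Z | lra]).
    assert (th s <= th u) by (apply (htf_th_mono F); lra).
    assert (th c < th t) by (apply (htf_th_after F); [exact Z | lra]).
    pose proof (sin_pos_half_turn (th c - th u) ltac:(lra)).
    replace (th u - th c) with (- (th c - th u)) by ring. rewrite sin_neg. nra. }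
  assert (G c < G t).
  { apply (derive_pos_incr G _ c t ltac:(lra) HG). intros u Hcu. cbv beta.
    specialize (Hr u Hcu).
    assert (th c < th u) by (apply (htf_th_after F); [exact Z | lra]).
    assert (th u <= th t) by (apply (htf_th_mono F); lra).
    assert (th s < th c) by (apply (htf_th_before F); [exact Z | lra]).
    pose proof (sin_pos_half_turn (th u - th c) ltac:(lra)). nra. }
  unfold G in *. lra.
Qed.

(** Directions along a regular arc stay within a right angle of the mean
    direction, so the arc advances in that direction. *)
Lemma regular_arc_not_closed x y rho th (F : half_turn_front x y rho th) (s t : R) :
  s < t <= s + 2 * PI -> (forall u, s < u < t -> rho u <> 0) ->
  x s = x t -> y s = y t -> False.
Proof.
  intros Hst Hz Ex Ey.
  assert (Htot : th t <= th s + PI).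
  { rewrite <- (htf_th_period F s). apply (htf_th_mono F). lra. }
  set (a := (th s + th t) / 2).
  assert (Hle : th s <= th t) by (apply (htf_th_mono F); lra).
  (* An interior point is needed, for the speed may vanish at the ends. *)
  assert (Hm : exists m, s < m < t /\ th m = a).
  { destruct (Req_dec (th s) (th t)) as [E | NE].
    - exists ((s + t) / 2). split; [lra | ].
      assert (th s <= th ((s + t) / 2)) by (apply (htf_th_mono F); lra).
      assert (th ((s + t) / 2) <= th t) by (apply (htf_th_mono F); lra).
      unfold a. lra.
    - destruct (IVT_gen th s t a (htf_th_cont F)) as (m & Hm & E).
      + rewrite Rmin_left, Rmax_right; unfold a; lra.
      + rewrite Rmin_left, Rmax_right in Hm by lra.
        exists m. split; [ | exact E].
        assert (m <> s) by (intros ->; unfold a in E; lra).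
        assert (m <> t) by (intros ->; unfold a in E; lra). lra. }
  destruct Hm as (m & Hm & Em).
  set (G := fun u => rho m * abscissa x y a u).
  assert (HG : forall u, is_derive G u (rho m * (rho u * cos (th u - a)))).
  { intros u. unfold G. apply (is_derive_scal (abscissa x y a)), abscissa_derive, F. }
  assert (Hmon : forall u v, s <= u -> u <= v -> v <= t -> G u <= G v).
  { intros u v Hu Huv Hv. apply (derive_nonneg_incr G _ u v Huv HG). intros w Hw. cbv beta.
    assert (0 < rho m * rho w)
      by (apply (zero_free_sign rho s t (htf_rho_cont _ _ _ _ F) Hz); lra).
    assert (th s <= th w) by (apply (htf_th_mono F); lra).
    assert (th w <= th t) by (apply (htf_th_mono F); lra).
    assert (0 <= cos (th w - a)) by (apply cos_ge_0; unfold a; lra).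
    nra. }
  destruct (is_derive_pos_local G m _ (HG m)) as (d & Hd & Hr & _).
  { rewrite Em, Rminus_diag, cos_0. pose proof (Hz m Hm). nra. }
  set (v := Rmin t (m + d / 2)).
  assert (Hv : m < v <= t /\ v < m + d).
  { unfold v. split; [split; [apply Rmin_glb_lt; lra | apply Rmin_l] | ].
    pose proof (Rmin_r t (m + d / 2)). lra. }
  specialize (Hr v ltac:(lra)).
  pose proof (Hmon s m ltac:(lra) ltac:(lra) ltac:(lra)).
  pose proof (Hmon v t ltac:(lra) ltac:(lra) ltac:(lra)).
  assert (G s = G t) by (unfold G, abscissa; rewrite Ex, Ey; reflexivity).
  lra.
Qed.

(** This yields both the lower bound on the number of cusps, for the loop over a
    whole period, and the simplicity of fronts with three cusps. *)
Lemma loop_has_two_cusps x y rho th (F : half_turn_front x y rho th) (s t : R) :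
  s < t <= s + 2 * PI -> x s = x t -> y s = y t ->
  exists u v, s < u /\ u < v /\ v < t /\ rho u = 0 /\ rho v = 0.
Proof.
  intros Hst Ex Ey.
  destruct (classic (exists c, s < c < t /\ rho c = 0)) as [(c & Hc & Z) | Hno].
  - apply NNPP. intros Hn.
    assert (Hu : forall u, s < u < t -> rho u = 0 -> u = c).
    { intros u Hu Zu. destruct (Rtotal_order u c) as [L | [E | G]]; [exfalso | exact E | exfalso].
      - apply Hn. exists u, c. repeat split; auto; lra.
      - apply Hn. exists c, u. repeat split; auto; lra. }
    pose proof (height_across_cusp x y rho th F s c t Hc ltac:(lra) Z Hu) as H.
    unfold height in H. rewrite Ex, Ey in H. lra.
  - exfalso. apply (regular_arc_not_closed x y rho th F s t Hst); [ | exact Ex | exact Ey].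
    intros u Hu Z. apply Hno. exists u. auto.
Qed.

(** * Height over the direction of a cusp *)

Lemma height_period x y rho th (F : half_turn_front x y rho th) (a t : R) :
  height x y a (t + 2 * PI) = height x y a t.
Proof. unfold height. now rewrite (htf_x_period F), (htf_y_period F). Qed.

Lemma angle_from_cusp x y rho th (F : half_turn_front x y rho th) (c t : R) :
  rho c = 0 -> c < t < c + 2 * PI -> 0 < sin (th t - th c).
Proof.
  intros Z Ht. apply sin_pos_half_turn.
  assert (th c < th t) by (apply (htf_th_after F); [exact Z | lra]).
  assert (th t < th (c + 2 * PI)).
  { apply (htf_th_before F); [ | lra]. rewrite (htf_rho_period F), Z. ring. }
  rewrite (htf_th_period F) in H0. lra.
Qed.

(** Away from the base cusp [c] the height changes in the sense given by the sign
    of [rho]; the factor [k], eventually 1 or -1, treats rising and falling arcs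
    alike. *)
Lemma height_incr_gap x y rho th (F : half_turn_front x y rho th) (c k u v : R) :
  rho c = 0 -> c <= u -> v <= c + 2 * PI -> (forall t, u < t < v -> 0 < k * rho t) ->
  incr_on (fun t => k * height x y (th c) t) u v.
Proof.
  intros Z Hu Hv Hp s t Hs Hst Ht.
  apply (derive_pos_incr (fun t => k * height x y (th c) t)
    (fun t => k * (rho t * sin (th t - th c))) s t Hst).
  - intros w. apply (is_derive_scal (height x y (th c))), height_derive, F.
  - intros w Hw. specialize (Hp w ltac:(lra)).
    pose proof (angle_from_cusp x y rho th F c w Z ltac:(lra)). nra.
Qed.

(** Passing the base cusp reverses both factors of the derivative of the height,
    so the height goes on in the same sense. *)
Lemma height_incr_wrap x y rho th (F : half_turn_front x y rho th) (c k u v : R) :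
  rho c = 0 -> c < u < c + 2 * PI -> c < v < c + 2 * PI ->
  (forall t, u < t < c + 2 * PI -> 0 < k * rho t) ->
  (forall t, c < t < v -> rho t <> 0) ->
  incr_on (fun t => k * height x y (th c) t) u (v + 2 * PI).
Proof.
  intros Z Hu Hv Hp Hn.
  assert (Hper : forall t, k * height x y (th c) (t + 2 * PI) = k * height x y (th c) t)
    by (intros t; now rewrite (height_period _ _ _ _ F)).
  assert (Zc : rho (c + 2 * PI) = 0) by (rewrite (htf_rho_period F), Z; ring).
  assert (Hk : forall t, c < t < v -> 0 < k * rho t).
  { destruct (single_zero_sign rho u (c + 2 * PI) (v + 2 * PI) (htf_rho F)
      ltac:(lra) Zc (htf_rho_simple F _ Zc)) as [Hr Hl].
    - intros t Ht Zt. destruct (Rtotal_order t (c + 2 * PI)) as [L | [E | G]]; [ | exact E | ].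
      + specialize (Hp t ltac:(lra)). rewrite Zt in Hp. lra.
      + exfalso. apply (Hn (t - 2 * PI)); [lra | ].
        replace t with (t - 2 * PI + 2 * PI) in Zt by ring.
        rewrite (htf_rho_period F) in Zt. lra.
    - intros t Ht. specialize (Hr (t + 2 * PI) ltac:(lra)).
      rewrite (htf_rho_period F) in Hr.
      set (m := (u + (c + 2 * PI)) / 2).
      specialize (Hl m ltac:(unfold m; lra)). specialize (Hp m ltac:(unfold m; lra)).
      assert (0 < rho t * rho m) by nra. nra. }
  apply incr_on_join with (c + 2 * PI); [lra | | ].
  - apply (height_incr_gap x y rho th F c k); [exact Z | lra | lra | exact Hp].
  - apply (incr_on_shift _ (2 * PI) c v Hper).
    apply (height_incr_gap x y rho th F c k); [exact Z | lra | lra | exact Hk].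
Qed.

(** At a cusp transversal to the base direction the height has a strict local
    extremum; which of the two branches lies further to the right is governed by
    the same sign that tells a maximum from a minimum. *)
Lemma height_turning_point x y rho th (F : half_turn_front x y rho th) (a q : R) :
  rho q = 0 -> sin (th q - a) <> 0 ->
  exists D d, 0 < d /\
    (forall t, q - d < t < q + d -> t <> q -> 0 < D * (height x y a t - height x y a q)) /\
    (forall t t', q - d < t < q -> q < t' < q + d -> height x y a t = height x y a t' ->
      D * (abscissa x y a t' - abscissa x y a t) < 0).
Proof.
  intros Z Hs.
  set (S := sin (th q - a)) in *. set (D := Derive rho q * S).
  destruct (simple_zeros_isolated rho q (htf_rho F) (htf_rho_simple F))
    as (d1 & Hd1 & Hi).
  assert (Hcs : continuity (fun t => sin (th t - a))).
  { apply (continuity_comp (fun t => th t - a) sin); [ | exact continuity_sin].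
    apply (continuity_minus th (fun _ => a)); [apply (htf_th_cont F) | ].
    apply continuity_const. intros ? ?; reflexivity. }
  destruct (Hcs q (Rabs S)) as (d2 & Hd2 & B); [apply Rabs_pos_lt, Hs | ].
  assert (Hsin : forall t, Rabs (t - q) < d2 -> 0 < S * sin (th t - a)).
  { intros t Ht. destruct (Req_dec t q) as [-> | N]; [fold S; nra | ].
    specialize (B t). simpl in B. unfold R_dist in B. fold S in B.
    assert (H : Rabs (sin (th t - a) - S) < Rabs S).
    { apply B. split; [split; [exact I | auto] | exact Ht]. }
    revert H. unfold Rabs. destruct (Rcase_abs (sin (th t - a) - S)), (Rcase_abs S); nra. }
  set (d := Rmin (Rmin d1 d2) PI).
  pose proof PI_RGT_0 as HPI.
  assert (0 < d /\ d <= d1 /\ d <= d2 /\ d <= PI) as (M0 & M1 & M2 & M3).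
  { unfold d. repeat split.
    - repeat apply Rmin_glb_lt; lra.
    - eapply Rle_trans; [apply Rmin_l | apply Rmin_l].
    - eapply Rle_trans; [apply Rmin_l | apply Rmin_r].
    - apply Rmin_r. }
  assert (Huniq : forall u, q - d < u < q + d -> rho u = 0 -> u = q)
    by (intros u Hu Zu; apply Hi; [lra | exact Zu]).
  exists D, d. split; [exact M0 | split].
  - destruct (single_zero_sign rho (q - d) q (q + d) (htf_rho F) ltac:(lra) Z
      (htf_rho_simple F q Z) Huniq) as [Hr Hl].
    assert (HG : forall u, is_derive (fun u => D * height x y a u) u
                                 (D * (rho u * sin (th u - a)))).
    { intros u. apply (is_derive_scal (height x y a)), height_derive, F. }
    intros t Ht N. destruct (Rlt_dec q t) as [L | L].
    + assert (H : D * height x y a q < D * height x y a t); [ | lra].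
      apply (derive_pos_incr _ _ q t L HG). intros w Hw. unfold D.
      specialize (Hr w ltac:(lra)).
      specialize (Hsin w ltac:(apply Rabs_def1; lra)).
      replace (_ * S * _) with ((Derive rho q * rho w) * (S * sin (th w - a))) by ring. nra.
    + assert (H : - D * height x y a t < - D * height x y a q); [ | lra].
      apply (derive_pos_incr (fun u => - D * height x y a u)
        (fun u => - D * (rho u * sin (th u - a))) t q); [lra | | ].
      * intros u. apply (is_derive_scal (height x y a)), height_derive, F.
      * intros w Hw. unfold D.
        specialize (Hl w ltac:(lra)).
        specialize (Hsin w ltac:(apply Rabs_def1; lra)).
        replace (- (_ * S) * _) with (- (Derive rho q * rho w) * (S * sin (th w - a))) by ring.
        nra.
  - intros t t' Ht Ht' E.
    assert (H : 0 < Derive rho q * (height x y (th q) t' - height x y (th q) t)).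
    { apply (height_across_cusp x y rho th F); [lra | lra | exact Z | ].
      intros u Hu. apply Huniq. lra. }
    rewrite (height_rotate x y a (th q) t), (height_rotate x y a (th q) t'), E in H.
    fold S in H. unfold D. lra.
Qed.

(** * Five cusps force a double point *)

Lemma StronglySorted_nth (l : list R) (i j : nat) :
  StronglySorted Rlt l -> (i < j < length l)%nat -> nth i l 0 < nth j l 0.
Proof.
  intros Hl. revert i j. induction Hl as [ | x l Hl IH Hx]; intros i j Hij; simpl in Hij; [lia | ].
  destruct j as [ | j]; [lia | ]. destruct i as [ | i]; simpl.
  - rewrite Forall_forall in Hx. apply Hx, nth_In. lia.
  - apply IH. lia.
Qed.

Lemma finite_argmin (h : nat -> R) (n : nat) :
  (0 < n)%nat -> exists i, (i < n)%nat /\ forall j, (j < n)%nat -> h i <= h j.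
Proof.
  induction n as [ | [ | n] IH]; intros Hn; [lia | | ].
  - exists 0%nat. split; [lia | ]. intros j Hj. replace j with 0%nat by lia. lra.
  - destruct IH as (i & Hi & Hm); [lia | ].
    destruct (Rle_dec (h i) (h (S n))) as [L | L]; [exists i | exists (S n)]; (split; [lia | ]);
      intros j Hj; destruct (Nat.eq_dec j (S n)) as [-> | N]; try lra.
    + apply Hm. lia.
    + specialize (Hm j ltac:(lia)). lra.
Qed.

(** Indexing by all natural numbers lets every arc have a next one. *)
Definition periodic_enum (l : list R) (j : nat) : R :=
  nth (j mod length l) l 0 + INR (j / length l) * (2 * PI).

(** The base cusp [c] is left out: it is no extremum of the height over its own
    direction. *)
Definition lists_later_cusps (rho : R -> R) (c : R) (l : list R) : Prop :=
  StronglySorted Rlt l /\ forall t, In t l <-> (c < t < c + 2 * PI /\ rho t = 0).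

Lemma periodic_enum_period (l : list R) (j : nat) :
  l <> nil -> periodic_enum l (j + length l) = periodic_enum l j + 2 * PI.
Proof.
  intros Hl. assert (length l <> 0)%nat by (destruct l; simpl; congruence).
  unfold periodic_enum.
  replace (j + length l)%nat with (j + 1 * length l)%nat by lia.
  rewrite Nat.Div0.mod_add, Nat.div_add, plus_INR by assumption. simpl. ring.
Qed.

Lemma periodic_enum_cases (l : list R) (j : nat) :
  l <> nil ->
  let n := length l in
  exists q i, (i < n)%nat /\ periodic_enum l j = nth i l 0 + INR q * (2 * PI) /\
    ((S i < n)%nat /\ periodic_enum l (S j) = nth (S i) l 0 + INR q * (2 * PI) \/
     S i = n /\ periodic_enum l (S j) = (nth 0 l 0 + 2 * PI) + INR q * (2 * PI)).
Proof.
  intros Hl n. assert (Hn : (n <> 0)%nat) by (unfold n; destruct l; simpl; congruence).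
  exists (j / n)%nat, (j mod n)%nat.
  pose proof (Nat.mod_upper_bound j n Hn). pose proof (Nat.div_mod_eq j n) as E.
  split; [assumption | split; [reflexivity | ]].
  unfold periodic_enum. fold n.
  destruct (Nat.eq_dec (S (j mod n)) n) as [W | W]; [right | left].
  - split; [assumption | ].
    rewrite <- (Nat.mod_unique (S j) n (S (j / n)) 0), <- (Nat.div_unique (S j) n (S (j / n)) 0);
      [rewrite S_INR; ring | nia ..].
  - split; [lia | ].
    rewrite <- (Nat.mod_unique (S j) n (j / n) (S (j mod n))),
      <- (Nat.div_unique (S j) n (j / n) (S (j mod n))); [reflexivity | nia ..].
Qed.

Lemma height_period_mult x y rho th (F : half_turn_front x y rho th) (a : R) (q : nat) (t : R) :
  height x y a (t + INR q * (2 * PI)) = height x y a t.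
Proof.
  induction q as [ | q IH].
  - simpl. now rewrite Rmult_0_l, Rplus_0_r.
  - rewrite S_INR.
    replace (t + (INR q + 1) * (2 * PI)) with (t + INR q * (2 * PI) + 2 * PI) by ring.
    now rewrite (height_period _ _ _ _ F).
Qed.

Lemma turning_time_singular x y rho th (F : half_turn_front x y rho th) (c : R) (l : list R) :
  rho c = 0 -> lists_later_cusps rho c l -> l <> nil ->
  forall j, rho (periodic_enum l j) = 0 /\ sin (th (periodic_enum l j) - th c) <> 0.
Proof.
  intros Z [Hs Hin] Hl j.
  destruct (periodic_enum_cases l j Hl) as (q & i & Hi & -> & _).
  destruct (proj1 (Hin _) (nth_In l 0 Hi)) as [Hc Zi].
  pose proof (angle_from_cusp x y rho th F c _ Z Hc).
  induction q as [ | q [IH1 IH2]].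
  - simpl. rewrite Rmult_0_l, Rplus_0_r. split; [exact Zi | lra].
  - rewrite S_INR. replace (nth i l 0 + (INR q + 1) * (2 * PI))
      with (nth i l 0 + INR q * (2 * PI) + 2 * PI) by ring.
    rewrite (htf_rho_period F), (htf_th_period F), IH1. split; [ring | ].
    match goal with |- context [sin (?A + PI - ?B)] =>
      replace (A + PI - B) with (A - B + PI) by ring end.
    rewrite neg_sin. lra.
Qed.

Lemma turning_arc_monotone x y rho th (F : half_turn_front x y rho th) (c : R) (l : list R) :
  rho c = 0 -> lists_later_cusps rho c l -> l <> nil ->
  forall j, periodic_enum l j < periodic_enum l (S j) /\
    exists k, (k = 1 \/ k = -1) /\
      incr_on (fun t => k * height x y (th c) t) (periodic_enum l j) (periodic_enum l (S j)).
Proof.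
  intros Z [Hs Hin] Hl j.
  assert (Hidx : forall t, c < t < c + 2 * PI -> rho t = 0 ->
    exists m, (m < length l)%nat /\ nth m l 0 = t).
  { intros t Ht Zt. apply In_nth, Hin. auto. }
  assert (Hel : forall i, (i < length l)%nat -> c < nth i l 0 < c + 2 * PI).
  { intros i Hi. apply (Hin (nth i l 0)), nth_In, Hi. }
  assert (Hper : forall k q t, k * height x y (th c) (t + INR q * (2 * PI))
                               = k * height x y (th c) t).
  { intros k q t. now rewrite (height_period_mult _ _ _ _ F). }
  assert (Hle : forall m i, (m <= i < length l)%nat -> nth m l 0 <= nth i l 0).
  { intros m i Hmi. destruct (Nat.eq_dec m i) as [-> | N]; [lra | ].
    left. apply StronglySorted_nth; [exact Hs | lia]. }
  (* Either no cusp separates the two times, or just a translate of [c] does. *)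
  destruct (periodic_enum_cases l j Hl) as (q & i & Hi & -> & [[Hi' ->] | [Hi' ->]]).
  - pose proof (StronglySorted_nth l i (S i) Hs ltac:(lia)) as Hlt.
    pose proof (Hel i Hi). pose proof (Hel (S i) Hi').
    assert (Hz : forall t, nth i l 0 < t < nth (S i) l 0 -> rho t <> 0).
    { intros t Ht Zt. destruct (Hidx t ltac:(lra) Zt) as (m & Hm & <-).
      destruct (le_lt_dec m i) as [L | L].
      - pose proof (Hle m i ltac:(lia)). lra.
      - pose proof (Hle (S i) m ltac:(lia)). lra. }
    destruct (constant_sign rho _ _ (htf_rho_cont _ _ _ _ F) Hlt Hz) as (k & Hk & Hp).
    split; [lra | ]. exists k. split; [exact Hk | ].
    apply (incr_on_shift _ _ _ _ (Hper k q)).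
    apply (height_incr_gap x y rho th F c k); [exact Z | lra | lra | exact Hp].
  - pose proof (Hel i Hi). pose proof (Hel 0%nat ltac:(lia)).
    assert (Hz : forall t, nth i l 0 < t < c + 2 * PI -> rho t <> 0).
    { intros t Ht Zt. destruct (Hidx t ltac:(lra) Zt) as (m & Hm & <-).
      pose proof (Hle m i ltac:(lia)). lra. }
    destruct (constant_sign rho (nth i l 0) (c + 2 * PI) (htf_rho_cont _ _ _ _ F) ltac:(lra) Hz)
      as (k & Hk & Hp).
    split; [lra | ]. exists k. split; [exact Hk | ].
    apply (incr_on_shift _ _ _ _ (Hper k q)).
    apply (height_incr_wrap x y rho th F c k); [exact Z | lra | lra | exact Hp | ].
    intros t Ht Zt. destruct (Hidx t ltac:(lra) Zt) as (m & Hm & <-).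
    pose proof (Hle 0%nat m ltac:(lia)). lra.
Qed.

Lemma extremum_sign_right (f : R -> R) (D d k q r : R) :
  0 < d -> q < r ->
  (forall t, q - d < t < q + d -> t <> q -> 0 < D * (f t - f q)) ->
  (k = 1 \/ k = -1) -> incr_on (fun t => k * f t) q r -> 0 < k * D.
Proof.
  intros Hd Hqr He Hk Hi. set (t := q + Rmin d (r - q) / 2).
  assert (0 < Rmin d (r - q)) by (apply Rmin_glb_lt; lra).
  pose proof (Rmin_l d (r - q)). pose proof (Rmin_r d (r - q)).
  specialize (He t ltac:(unfold t; lra) ltac:(unfold t; lra)).
  specialize (Hi q t ltac:(lra) ltac:(unfold t; lra) ltac:(unfold t; lra)). simpl in Hi.
  destruct Hk as [-> | ->]; nra.
Qed.

Lemma extremum_sign_left (f : R -> R) (D d k p q : R) :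
  0 < d -> p < q ->
  (forall t, q - d < t < q + d -> t <> q -> 0 < D * (f t - f q)) ->
  (k = 1 \/ k = -1) -> incr_on (fun t => k * f t) p q -> k * D < 0.
Proof.
  intros Hd Hqr He Hk Hi. set (t := q - Rmin d (q - p) / 2).
  assert (0 < Rmin d (q - p)) by (apply Rmin_glb_lt; lra).
  pose proof (Rmin_l d (q - p)). pose proof (Rmin_r d (q - p)).
  specialize (He t ltac:(unfold t; lra) ltac:(unfold t; lra)).
  specialize (Hi t q ltac:(unfold t; lra) ltac:(unfold t; lra) ltac:(lra)). simpl in Hi.
  destruct Hk as [-> | ->]; nra.
Qed.

(** The arc from [q] to [r] is at most as high as its neighbours.  If it falls, the
    sign in [height_turning_point] puts both neighbours to its left; if it rises,
    a half turn of the plane reduces to that case. *)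
Lemma short_arc_crossing x y rho th (F : half_turn_front x y rho th) (c p q r s : R) :
  p < q -> q < r -> r < s ->
  rho q = 0 -> sin (th q - th c) <> 0 -> rho r = 0 -> sin (th r - th c) <> 0 ->
  let Y := height x y (th c) in
  (exists k, (k = 1 \/ k = -1) /\ incr_on (fun t => k * Y t) p q) ->
  (exists k, (k = 1 \/ k = -1) /\ incr_on (fun t => k * Y t) q r) ->
  (exists k, (k = 1 \/ k = -1) /\ incr_on (fun t => k * Y t) r s) ->
  Rabs (Y r - Y q) <= Rabs (Y q - Y p) -> Rabs (Y r - Y q) <= Rabs (Y s - Y r) ->
  exists u v, p <= u /\ u < v /\ v <= s /\ x u = x v /\ y u = y v.
Proof.
  intros Hpq Hqr Hrs Zq Sq Zr Sr Y (k1 & K1 & I1) (k2 & K2 & I2) (k3 & K3 & I3) HL HR.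
  set (X := abscissa x y (th c)).
  destruct (height_turning_point x y rho th F (th c) q Zq Sq) as (Dq & dq & Hdq & Eq & Wq).
  destruct (height_turning_point x y rho th F (th c) r Zr Sr) as (Dr & dr & Hdr & Er & Wr).
  fold Y in Eq, Wq, Er, Wr. fold X in Wq, Wr.
  pose proof (extremum_sign_left Y Dq dq k1 p q Hdq Hpq Eq K1 I1) as S1.
  pose proof (extremum_sign_right Y Dq dq k2 q r Hdq Hqr Eq K2 I2) as S2.
  pose proof (extremum_sign_left Y Dr dr k2 q r Hdr Hqr Er K2 I2) as S3.
  pose proof (extremum_sign_right Y Dr dr k3 r s Hdr Hrs Er K3 I3) as S4.
  assert (E1 : k1 = - k2) by (destruct K1 as [-> | ->], K2 as [-> | ->]; nra).
  assert (E3 : k3 = - k2) by (destruct K2 as [-> | ->], K3 as [-> | ->]; nra).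
  subst k1 k3.
  set (d := Rmin dq dr).
  assert (Hd : 0 < d) by (apply Rmin_glb_lt; assumption).
  assert (Hd1 : d <= dq) by apply Rmin_l. assert (Hd2 : d <= dr) by apply Rmin_r.
  assert (cX : continuity X).
  { apply ex_derive_continuity. intros t. eexists. apply (abscissa_derive x y rho th F). }
  assert (cY : continuity Y).
  { apply ex_derive_continuity. intros t. eexists. apply (height_derive x y rho th F). }
  pose proof (I1 p q ltac:(lra) Hpq ltac:(lra)) as O1. cbv beta in O1.
  pose proof (I2 q r ltac:(lra) Hqr ltac:(lra)) as O2. cbv beta in O2.
  pose proof (I3 r s ltac:(lra) Hrs ltac:(lra)) as O3. cbv beta in O3.
  destruct (zigzag_crossing (fun t => - k2 * X t) (fun t => - k2 * Y t) p q r s d)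
    as (u & v & Hu & Huv & Hv & EX & EY); try assumption.
  - apply (continuity_scal X _ cX).
  - apply (continuity_scal Y _ cY).
  - intros u v Hu Huv Hv. specialize (I2 u v Hu Huv Hv). lra.
  - revert HL. unfold Rabs.
    destruct (Rcase_abs (Y r - Y q)), (Rcase_abs (Y q - Y p)), K2 as [-> | ->]; lra.
  - revert HR. unfold Rabs.
    destruct (Rcase_abs (Y r - Y q)), (Rcase_abs (Y s - Y r)), K2 as [-> | ->]; lra.
  - intros t t' Ht Ht' E.
    assert (EY : Y t = Y t') by (destruct K2 as [-> | ->]; lra).
    specialize (Wq t t' ltac:(lra) ltac:(lra) EY).
    destruct K2 as [-> | ->]; nra.
  - intros t t' Ht Ht' E.
    assert (EY : Y t = Y t') by (destruct K2 as [-> | ->]; lra).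
    specialize (Wr t t' ltac:(lra) ltac:(lra) EY).
    destruct K2 as [-> | ->]; nra.
  - exists u, v. repeat split; try assumption.
    + assert (EX' : X u = X v) by (destruct K2 as [-> | ->]; lra).
      assert (EY' : Y u = Y v) by (destruct K2 as [-> | ->]; lra).
      pose proof (sin2_cos2 (th c)) as T. unfold Rsqr in T.
      assert (Hx : forall t, x t = cos (th c) * X t - sin (th c) * Y t).
      { intros t. unfold X, Y, abscissa, height. rewrite <- (Rmult_1_l (x t)) at 1.
        rewrite <- T. ring. }
      rewrite (Hx u), (Hx v), EX', EY'. reflexivity.
    + assert (EX' : X u = X v) by (destruct K2 as [-> | ->]; lra).
      assert (EY' : Y u = Y v) by (destruct K2 as [-> | ->]; lra).
      pose proof (sin2_cos2 (th c)) as T. unfold Rsqr in T.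
      assert (Hy : forall t, y t = sin (th c) * X t + cos (th c) * Y t).
      { intros t. unfold X, Y, abscissa, height. rewrite <- (Rmult_1_l (y t)) at 1.
        rewrite <- T. ring. }
      rewrite (Hy u), (Hy v), EX', EY'. reflexivity.
Qed.

(** The arcs between successive turning points recur with the period, so one of
    them has least height extent and is crossed by a neighbour or makes its
    neighbours cross.  Three consecutive arcs out of at least four span less than
    a period, so the two times found are distinct on the circle. *)
Lemma many_cusps_double_point x y rho th (F : half_turn_front x y rho th) (c : R) (l : list R) :
  rho c = 0 -> lists_later_cusps rho c l -> (4 <= length l)%nat ->
  exists u v, u < v < u + 2 * PI /\ x u = x v /\ y u = y v.
Proof.
  intros Z Hl Hn.
  assert (Hnil : l <> nil) by (intros ->; simpl in Hn; lia).
  set (n := length l) in *. set (z := periodic_enum l). set (Y := height x y (th c)).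
  pose proof (turning_arc_monotone x y rho th F c l Z Hl Hnil) as Harc.
  pose proof (turning_time_singular x y rho th F c l Z Hl Hnil) as Hsing.
  fold z in Harc, Hsing. fold Y in Harc.
  assert (Hper : forall j, z (j + n)%nat = z j + 2 * PI)
    by (intros j; apply periodic_enum_period, Hnil).
  set (h := fun j => Rabs (Y (z (S j)) - Y (z j))).
  assert (Hh : forall j, h (j + n)%nat = h j).
  { intros j. unfold h. rewrite Hper. replace (S (j + n)) with (S j + n)%nat by lia.
    rewrite Hper. unfold Y. now rewrite !(height_period _ _ _ _ F). }
  destruct (finite_argmin h n ltac:(lia)) as (i & Hi & Hmin).
  assert (Hmin' : forall j, h (i + n)%nat <= h j).
  { intros j. rewrite Hh. rewrite (Nat.div_mod_eq j n).
    generalize (j / n)%nat. intros m.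
    replace (n * m + j mod n)%nat with (j mod n + m * n)%nat by lia.
    induction m as [ | m IH].
    - rewrite Nat.mul_0_l, Nat.add_0_r. apply Hmin, Nat.mod_upper_bound. lia.
    - replace (j mod n + S m * n)%nat with (j mod n + m * n + n)%nat by lia. now rewrite Hh. }
  (* The shift by a period gives the least arc a predecessor. *)
  set (j := (i + n - 1)%nat). replace (i + n)%nat with (S j) in Hmin' by (unfold j; lia).
  pose proof (proj1 (Harc j)). pose proof (proj1 (Harc (S j))).
  pose proof (proj1 (Harc (S (S j)))).
  destruct (short_arc_crossing x y rho th F c (z j) (z (S j)) (z (S (S j))) (z (S (S (S j)))))
    as (u & v & Hu & Huv & Hv & Ex & Ey); try assumption.
  - apply Hsing.
  - apply Hsing.
  - apply Hsing.
  - apply Hsing.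
  - apply (Harc j).
  - apply (Harc (S j)).
  - apply (Harc (S (S j))).
  - apply (Hmin' j).
  - apply (Hmin' (S (S j))).
  - exists u, v. split; [split; [exact Huv | ] | split; assumption].
    assert (Hinc : forall m, z (S (S (S j))) < z (S (S (S (S j))) + m)%nat).
    { induction m as [ | m IH]; [rewrite Nat.add_0_r; apply Harc | ].
      rewrite Nat.add_succ_r. pose proof (proj1 (Harc (S (S (S (S j))) + m)%nat)). lra. }
    specialize (Hinc (n - 4)%nat).
    replace (S (S (S (S j))) + (n - 4))%nat with (j + n)%nat in Hinc by lia.
    rewrite Hper in Hinc. lra.
Qed.

(** * Counting cusps *)

Lemma period_representative (t : R) :
  exists (m : Z) (s : R), in_period s /\ t = s + IZR m * (2 * PI).
Proof.
  pose proof PI_RGT_0 as HPI.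
  exists (Int_part (t / (2 * PI))), (t - IZR (Int_part (t / (2 * PI))) * (2 * PI)).
  split; [ | ring]. unfold in_period.
  destruct (base_Int_part (t / (2 * PI))) as [A B].
  assert (E : t = t / (2 * PI) * (2 * PI)) by (field; lra).
  set (w := t / (2 * PI)) in *. rewrite E. nra.
Qed.

Lemma periodic_Z (f : R -> R) :
  (forall t, f (t + 2 * PI) = f t) ->
  forall (m : Z) t, f (t + IZR m * (2 * PI)) = f t.
Proof.
  intros Hp m t. induction m as [ | m IH | m IH] using Z.peano_ind.
  - now rewrite Rmult_0_l, Rplus_0_r.
  - rewrite succ_IZR, <- IH.
    replace (t + (IZR m + 1) * (2 * PI)) with (t + IZR m * (2 * PI) + 2 * PI) by ring. apply Hp.
  - rewrite <- IH, <- (Hp (t + IZR (Z.pred m) * (2 * PI))). f_equal.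
    replace (IZR m) with (IZR (Z.pred m) + 1); [ring | ].
    rewrite <- succ_IZR. f_equal. lia.
Qed.

Lemma half_turn_front_cusps x y rho th (F : half_turn_front x y rho th) :
  exists N : nat,
    has_card (fun t => in_period t /\ rho t = 0) N /\
    Nat.Odd N /\ (3 <= N)%nat /\
    (N = 3%nat <->
     forall s t, in_period s -> in_period t -> x s = x t -> y s = y t -> s = t).
Proof.
  pose proof PI_RGT_0 as HPI.
  pose proof (htf_rho_cont _ _ _ _ F) as Hrc.
  destruct (simple_zeros_finite rho 0 (2 * PI) (htf_rho F) (htf_rho_simple F) ltac:(lra))
    as (L & HL & Hin).
  destruct L as [ | c l].
  { exfalso. destruct (IVT_cor rho 0 (2 * PI) Hrc) as (z & Hz & Z); [lra | | ].
    - replace (2 * PI) with (0 + 2 * PI) by ring. rewrite (htf_rho_period F). nra.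
    - destruct (Req_dec z (2 * PI)) as [E | N].
      + apply (proj2 (Hin 0)). split; [lra | ].
        replace z with (0 + 2 * PI) in Z by lra. rewrite (htf_rho_period F) in Z. lra.
      + apply (proj2 (Hin z)). split; [lra | exact Z]. }
  destruct (proj1 (Hin c) (or_introl eq_refl)) as [Hc Zc].
  apply StronglySorted_inv in HL. destruct HL as [Hl Hlt]. rewrite Forall_forall in Hlt.
  assert (Hback : forall t, rho (t - 2 * PI) = - rho t).
  { intros t. replace t with (t - 2 * PI + 2 * PI) at 2 by ring.
    rewrite (htf_rho_period F). ring. }
  (* [c] is the first cusp in the period, so the other cusps are exactly those
     of the open period that follows [c]. *)
  assert (Hl' : lists_later_cusps rho c l).
  { split; [exact Hl | ]. intros t. split.
    - intros Ht. specialize (Hlt t Ht).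
      destruct (proj1 (Hin t) (or_intror Ht)). split; [lra | assumption].
    - intros [Ht Z]. destruct (Rlt_dec t (2 * PI)) as [L | L].
      + destruct (proj2 (Hin t)) as [E | Hlast]; [split; [lra | exact Z] | lra | exact Hlast].
      + exfalso. destruct (proj2 (Hin (t - 2 * PI))) as [E | Hlast].
        * split; [lra | ]. rewrite Hback, Z. ring.
        * lra.
        * apply Hlt in Hlast. lra. }
  (* A period starting shortly before [c] has regular ends, where [rho] takes
     opposite values. *)
  assert (Hodd : Nat.Odd (S (length l))).
  { destruct (simple_zeros_isolated rho c (htf_rho F) (htf_rho_simple F)) as (d & Hd & Hi).
    set (e := Rmin d PI / 2).
    assert (He : 0 < e /\ e < d /\ e < 2 * PI).
    { unfold e. pose proof (Rmin_l d PI). pose proof (Rmin_r d PI).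
      assert (0 < Rmin d PI) by (apply Rmin_glb_lt; lra). lra. }
    assert (Ha : rho (c - e) <> 0).
    { intros Z. apply Hi in Z; lra. }
    assert (Hb : rho (c - e + 2 * PI) = - rho (c - e)) by apply (htf_rho_period F).
    destruct (Nat.Even_or_Odd (length (c :: l))) as [Ev | O]; [exfalso | exact O].
    apply (simple_zeros_parity rho (c :: l) (htf_rho F) (htf_rho_simple F)) with
      (a := c - e) (b := c - e + 2 * PI) in Ev.
    - rewrite Hb in Ev. nra.
    - constructor; [exact Hl | apply Forall_forall; exact Hlt].
    - lra.
    - exact Ha.
    - rewrite Hb. lra.
    - intros t. destruct Hl' as [_ Hl']. simpl. rewrite Hl'. split.
      + intros [<- | [Ht Z]]; (split; [ | assumption]); [lra | ].
        split; [lra | ]. apply Rnot_le_lt. intros Hge.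
        assert (t - 2 * PI = c); [ | lra]. apply Hi; [lra | ]. rewrite Hback, Z. ring.
      + intros [Ht Z]. destruct (Rtotal_order t c) as [Lc | [E | G]].
        * left. symmetry. apply Hi; [lra | exact Z].
        * left. auto.
        * right. split; [lra | exact Z]. }
  assert (Hnd : NoDup (c :: l)).
  { clear - Hl Hlt. constructor; [intros H; apply Hlt in H; lra | ].
    clear Hlt. induction Hl as [ | a l Hl IH Ha]; constructor; [ | exact IH].
    intros H. rewrite Forall_forall in Ha. apply Ha in H. lra. }
  exists (S (length l)). split; [ | split; [exact Hodd | ]].
  { exists (c :: l). split; [exact Hnd | split; [reflexivity | exact Hin]]. }
  assert (H3 : (3 <= S (length l))%nat).
  { assert (length l <> 0)%nat; [ | destruct Hodd as [m Hm]; lia].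
    intros E. apply length_zero_iff_nil in E. subst l.
    destruct (loop_has_two_cusps x y rho th F c (c + 2 * PI)) as (u & v & Hu & Huv & Hv & Zu & Zv).
    - lra.
    - symmetry. apply (htf_x_period F).
    - symmetry. apply (htf_y_period F).
    - apply (proj2 Hl' u). split; [lra | exact Zu]. }
  split; [exact H3 | split].
  - intros HN.
    assert (Hlt2 : forall s t, in_period s -> in_period t -> x s = x t -> y s = y t -> ~ s < t).
    { intros s t Hs Ht Ex Ey Hst. unfold in_period in *.
      destruct (loop_has_two_cusps x y rho th F s t) as (u1 & u2 & U1 & U2 & U3 & Z1 & Z2);
        [lra | exact Ex | exact Ey | ].
      destruct (loop_has_two_cusps x y rho th F t (s + 2 * PI))
        as (v1 & v2 & V1 & V2 & V3 & W1 & W2).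
      { lra. }
      { rewrite (htf_x_period F). auto. }
      { rewrite (htf_y_period F). auto. }
      (* Brought back to the base period, the cusps of the two complementary loops
         are four distinct ones. *)
      set (w := fun v => if Rlt_dec v (2 * PI) then v else v - 2 * PI).
      assert (Hw : forall v, t < v < s + 2 * PI -> rho v = 0 ->
        (t < w v \/ w v < s) /\ In (w v) (c :: l)).
      { intros v Hv Zv. unfold w. destruct (Rlt_dec v (2 * PI)).
        - split; [lra | ]. apply Hin. split; [lra | exact Zv].
        - split; [lra | ]. apply Hin. split; [lra | ]. rewrite Hback, Zv. ring. }
      destruct (Hw v1 ltac:(lra) W1) as [A1 I1]. destruct (Hw v2 ltac:(lra) W2) as [A2 I2].
      assert (A12 : w v1 <> w v2).
      { unfold w. destruct (Rlt_dec v1 (2 * PI)), (Rlt_dec v2 (2 * PI)); lra. }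
      pose proof (NoDup_incl_length (l := u1 :: u2 :: w v1 :: w v2 :: nil) (l' := c :: l)) as HB.
      simpl in HB. rewrite HN in HB. assert (4 <= 3)%nat; [ | lia]. apply HB.
      - repeat constructor; simpl; intros K; intuition lra.
      - intros a [<- | [<- | [<- | [<- | []]]]]; [ | | exact I1 | exact I2];
          apply Hin; (split; [lra | assumption]). }
    intros s t Hs Ht Ex Ey. destruct (Rtotal_order s t) as [L | [E | G]]; [ | exact E | ].
    + exfalso. apply (Hlt2 s t); assumption.
    + exfalso. apply (Hlt2 t s); auto.
  - intros Hinj. destruct (Nat.eq_dec (S (length l)) 3) as [E | NE]; [exact E | exfalso].
    destruct (many_cusps_double_point x y rho th F c l Zc Hl') as (u & v & Huv & Ex & Ey).
    { destruct Hodd as [m Hm]. lia. }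
    destruct (period_representative u) as (m & s & Hs & Es).
    destruct (period_representative v) as (k & t & Ht & Et).
    assert (s = t).
    { apply Hinj; [exact Hs | exact Ht | | ].
      - rewrite <- (periodic_Z x (htf_x_period F) m s), <- (periodic_Z x (htf_x_period F) k t).
        now rewrite <- Es, <- Et.
      - rewrite <- (periodic_Z y (htf_y_period F) m s), <- (periodic_Z y (htf_y_period F) k t).
        now rewrite <- Es, <- Et. }
    subst t. assert (Hmk : 0 < IZR (k - m) < 1) by (rewrite minus_IZR; nra).
    destruct Hmk as [A B]. apply lt_IZR in A, B. lia.
Qed.

(** * Angle function of a unit field *)

Lemma unit_vector_angle (a b : R) : a ^ 2 + b ^ 2 = 1 -> exists w, a = cos w /\ b = sin w.
Proof.
  intros H. assert (Ha : -1 <= a <= 1) by nra.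
  assert (Hs : Rabs b = sin (acos a)).
  { rewrite sin_acos by exact Ha. rewrite <- sqrt_Rsqr_abs. f_equal. unfold Rsqr. lra. }
  destruct (Rle_dec 0 b) as [L | L].
  - exists (acos a). rewrite cos_acos by exact Ha. rewrite Rabs_pos_eq in Hs by exact L. auto.
  - exists (- acos a). rewrite cos_neg, sin_neg, cos_acos by exact Ha.
    rewrite Rabs_left in Hs by lra. split; lra.
Qed.

Lemma constant_of_derive_zero (f : R -> R) :
  (forall t, is_derive f t 0) -> forall s t, f s = f t.
Proof.
  assert (H : forall f : R -> R, (forall t, is_derive f t 0) -> forall s t, s < t -> f s = f t).
  { intros h Hd s t Hst. apply (eq_is_derive h s t); [ | exact Hst]. intros u _. apply Hd. }
  intros Hd s t. destruct (Rtotal_order s t) as [L | [-> | G]]; [now apply H | reflexivity | ].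
  symmetry. now apply H.
Qed.

Lemma antiderivative_exists (k : R -> R) (w : R) :
  (forall t, continuous k t) ->
  exists th : R -> R, th 0 = w /\ forall t, is_derive th t (k t).
Proof.
  intros Hk.
  assert (Hi : forall b, is_RInt k 0 b (RInt k 0 b)).
  { intros b. apply (RInt_correct k), (ex_RInt_continuous k). intros z _. apply Hk. }
  exists (fun t => w + RInt k 0 t). split.
  - rewrite RInt_point. unfold zero; simpl. ring.
  - intros t. replace (k t) with (0 + k t) by ring.
    apply (is_derive_plus (fun _ => w) (fun t => RInt k 0 t)); [apply @is_derive_const | ].
    apply (is_derive_RInt k (RInt k 0) 0 t); [ | apply Hk].
    apply filter_forall. exact Hi.
Qed.

(** The angle is the integral of the curvature: the moving frame of the candidate
    angle rotates at the same rate as the field, so their scalar and vector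
    products are constant. *)
Lemma unit_field_angle (a b : R -> R) :
  (forall t, ex_derive a t) -> (forall t, ex_derive b t) ->
  (forall t, continuous (Derive a) t) -> (forall t, continuous (Derive b) t) ->
  (forall t, a t ^ 2 + b t ^ 2 = 1) ->
  exists th : R -> R, (forall t, is_derive th t (a t * Derive b t - b t * Derive a t)) /\
    forall t, a t = cos (th t) /\ b t = sin (th t).
Proof.
  intros Ha Hb Ca Cb H1.
  set (k := fun t => a t * Derive b t - b t * Derive a t).
  assert (Hk : forall t, continuous k t).
  { intros t. unfold k.
    apply (continuous_minus (fun t => a t * Derive b t) (fun t => b t * Derive a t)).
    - apply (continuous_mult a (Derive b)); [apply (ex_derive_continuous a t (Ha t)) | apply Cb].
    - apply (continuous_mult b (Derive a)); [apply (ex_derive_continuous b t (Hb t)) | apply Ca]. }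
  destruct (unit_vector_angle (a 0) (b 0) (H1 0)) as (w & Ew1 & Ew2).
  destruct (antiderivative_exists k w Hk) as (th & E0 & Hth).
  exists th. split; [exact Hth | ].
  assert (Horth : forall t, a t * Derive a t + b t * Derive b t = 0).
  { intros t.
    assert (Hd : is_derive (fun t => a t ^ 2 + b t ^ 2) t (2 * (a t * Derive a t + b t * Derive b t))).
    { auto_derive; [repeat split; auto | ].
      change (Derive (fun x => a x) t) with (Derive a t).
      change (Derive (fun x => b x) t) with (Derive b t). ring. }
    assert (Hd0 : is_derive (fun t => a t ^ 2 + b t ^ 2) t 0).
    { apply (is_derive_ext (fun _ => 1)); [intros s; now rewrite H1 | apply @is_derive_const]. }
    pose proof (is_derive_unique _ _ _ Hd) as U. rewrite (is_derive_unique _ _ _ Hd0) in U. lra. }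
  assert (Hda : forall t, Derive a t = - (k t * b t)).
  { intros t. apply Rminus_diag_uniq. unfold k.
    transitivity (Derive a t * (1 - (a t ^ 2 + b t ^ 2))
                  + a t * (a t * Derive a t + b t * Derive b t)); [ring | ].
    rewrite H1, Horth. ring. }
  assert (Hdb : forall t, Derive b t = k t * a t).
  { intros t. apply Rminus_diag_uniq. unfold k.
    transitivity (Derive b t * (1 - (a t ^ 2 + b t ^ 2))
                  + b t * (a t * Derive a t + b t * Derive b t)); [ring | ].
    rewrite H1, Horth. ring. }
  assert (HA : forall t, is_derive (fun t => a t * cos (th t) + b t * sin (th t)) t 0).
  { intros t. auto_derive; [repeat split; eauto; eexists; apply Hth | ].
    change (Derive (fun x => a x) t) with (Derive a t).
    change (Derive (fun x => b x) t) with (Derive b t).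
    change (Derive (fun x => th x) t) with (Derive th t).
    rewrite (is_derive_unique th t _ (Hth t)), Hda, Hdb. ring. }
  assert (HB : forall t, is_derive (fun t => b t * cos (th t) - a t * sin (th t)) t 0).
  { intros t. auto_derive; [repeat split; eauto; eexists; apply Hth | ].
    change (Derive (fun x => a x) t) with (Derive a t).
    change (Derive (fun x => b x) t) with (Derive b t).
    change (Derive (fun x => th x) t) with (Derive th t).
    rewrite (is_derive_unique th t _ (Hth t)), Hda, Hdb. ring. }
  intros t.
  pose proof (constant_of_derive_zero _ HA t 0) as A. pose proof (constant_of_derive_zero _ HB t 0) as B.
  cbv beta in A, B. rewrite E0, Ew1, Ew2 in A, B.
  pose proof (sin2_cos2 w) as Tw. pose proof (sin2_cos2 (th t)) as Tt. unfold Rsqr in Tw, Tt.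
  replace (cos w * cos w + sin w * sin w) with 1 in A by lra.
  replace (sin w * cos w - cos w * sin w) with 0 in B by ring.
  split.
  - replace (a t) with (a t * (sin (th t) * sin (th t) + cos (th t) * cos (th t)))
      by (rewrite Tt; ring).
    transitivity ((a t * cos (th t) + b t * sin (th t)) * cos (th t)
                  - (b t * cos (th t) - a t * sin (th t)) * sin (th t)); [ring | ].
    rewrite A, B. ring.
  - replace (b t) with (b t * (sin (th t) * sin (th t) + cos (th t) * cos (th t)))
      by (rewrite Tt; ring).
    transitivity ((a t * cos (th t) + b t * sin (th t)) * sin (th t)
                  + (b t * cos (th t) - a t * sin (th t)) * cos (th t)); [ring | ].
    rewrite A, B. ring.
Qed.

Lemma Derive_shift (f : R -> R) (T k t : R) :
  (forall s, ex_derive f s) -> (forall s, f (s + T) = k * f s) ->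
  Derive f (t + T) = k * Derive f t.
Proof.
  intros He Hp. rewrite <- Derive_scal.
  rewrite <- (Derive_ext (fun s => f (s + T)) (fun s => k * f s) t Hp).
  symmetry. apply is_derive_unique.
  replace (Derive f (t + T)) with (1 * Derive f (t + T)) by ring.
  apply (is_derive_comp f (fun s => s + T)).
  - apply Derive_correct, He.
  - auto_derive; [exact I | ring].
Qed.

(** A turning by exactly the total curvature leaves no room for turning back. *)
Lemma curvature_sign (k : R -> R) (T : R) :
  0 < T -> (forall t, continuous k t) ->
  RInt k 0 T = RInt (fun t => Rabs (k t)) 0 T ->
  forall t, 0 < t < T -> 0 <= k t.
Proof.
  intros HT Hk E.
  assert (Hak : forall t, continuous (fun t => Rabs (k t)) t).
  { intros t. apply (continuous_comp k Rabs); [apply Hk | apply (continuous_abs (k t))]. }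
  set (h := fun t => minus (Rabs (k t)) (k t)).
  assert (Hh : forall t, continuous h t).
  { intros t. apply (continuous_minus (fun t => Rabs (k t)) k); [apply Hak | apply Hk]. }
  assert (Hint : forall (f : R -> R) a b, (forall t, continuous f t) -> ex_RInt f a b).
  { intros f a b Hf. apply (ex_RInt_continuous f). intros z _. apply Hf. }
  assert (Hpos : forall t, 0 <= h t).
  { intros t. unfold h, minus, plus, opp; simpl. pose proof (Rle_abs (k t)). lra. }
  assert (H0 : RInt h 0 T = 0).
  { apply (is_RInt_unique h).
    replace 0 with (minus (RInt (fun t => Rabs (k t)) 0 T) (RInt k 0 T)) at 2
      by (rewrite E; unfold minus, plus, opp; simpl; ring).
    apply (is_RInt_minus (fun t => Rabs (k t)) k).
    - apply (RInt_correct (fun t => Rabs (k t))), Hint, Hak.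
    - apply (RInt_correct k), Hint, Hk. }
  intros t Ht. apply Rnot_lt_le. intros Hneg.
  assert (Hht : 0 < h t).
  { unfold h, minus, plus, opp; simpl. rewrite Rabs_left by lra. lra. }
  assert (Hch : continuity h).
  { intros s. apply continuity_pt_filterlim. apply Hh. }
  destruct (Hch t (h t)) as (d & Hd & B); [exact Hht | ].
  set (m := Rmin d (Rmin t (T - t)) / 2).
  assert (Hm : 0 < m /\ m < d /\ m < t /\ m < T - t).
  { unfold m. pose proof (Rmin_l d (Rmin t (T - t))). pose proof (Rmin_r d (Rmin t (T - t))).
    pose proof (Rmin_l t (T - t)). pose proof (Rmin_r t (T - t)).
    assert (0 < Rmin d (Rmin t (T - t))) by (repeat apply Rmin_glb_lt; lra). lra. }
  assert (Hmid : 0 < RInt h (t - m) (t + m)).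
  { apply RInt_gt_0; [lra | | intros; apply Hh]. intros s Hs.
    destruct (Req_dec t s) as [<- | N]; [exact Hht | ].
    specialize (B s). simpl in B. unfold R_dist in B.
    assert (K : Rabs (h s - h t) < h t).
    { apply B. split; [split; [exact I | exact N] | ]. apply Rabs_def1; lra. }
    apply Rabs_def2 in K. lra. }
  assert (Hl : 0 <= RInt h 0 (t - m)) by (apply RInt_ge_0; [lra | apply Hint, Hh | intros; apply Hpos]).
  assert (Hr : 0 <= RInt h (t + m) T) by (apply RInt_ge_0; [lra | apply Hint, Hh | intros; apply Hpos]).
  pose proof (RInt_Chasles h 0 (t - m) (t + m) (Hint h _ _ Hh) (Hint h _ _ Hh)) as C1.
  pose proof (RInt_Chasles h 0 (t + m) T (Hint h _ _ Hh) (Hint h _ _ Hh)) as C2.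
  unfold plus in C1, C2; simpl in C1, C2. lra.
Qed.

(** * Cusps as simple zeros of the signed speed *)

Lemma smooth2_lipschitz_at (f : R -> R -> R) (x y : R) :
  locally_2d (fun u v => ex_diff_n f 1 u v) x y ->
  exists D, 0 <= D /\
    locally_2d (fun u v => Rabs (f u v - f x y) <= D * Rmax (Rabs (u - x)) (Rabs (v - y))) x y.
Proof.
  intros H. destruct (Taylor_Lagrange_2d f 0 x y H) as (D & HD).
  exists (Rabs D). split; [apply Rabs_pos | ]. revert HD. apply locally_2d_impl.
  apply locally_2d_forall. intros u v HD.
  replace (DL_pol 0 f x y (u - x) (v - y)) with (f x y) in HD.
  - rewrite pow_1 in HD. apply Rle_trans with (1 := HD).
    apply Rmult_le_compat_r; [ | apply Rle_abs].
    apply Rle_trans with (2 := Rmax_l _ _). apply Rabs_pos.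
  - unfold DL_pol, differential, partial_derive, Binomial.C. simpl. field.
Qed.

(** In cuspidal coordinates the first component is [t ^ 2], the coordinates are
    Lipschitz functions of the position, and the change of parameter is Lipschitz
    at the cusp. *)
Lemma cusp_quadratic_lower_bound (g : R -> R * R) (c : R) :
  is_cusp g c -> continuous (fun t => fst (g t)) c -> continuous (fun t => snd (g t)) c ->
  exists C, 0 <= C /\ forall d, 0 < d -> exists u, u <> c /\ Rabs (u - c) < d /\
    (u - c) ^ 2 <= C * Rmax (Rabs (fst (g u) - fst (g c))) (Rabs (snd (g u) - snd (g c))).
Proof.
  intros [_ (phi & Phi & (U & V & h & OU & _ & U0 & _ & _ & Sphi & _) & Ephi &
    (U' & V' & h' & OU' & _ & Up & _ & _ & SPhi & _) & Heq)] C1 C2.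
  pose proof (Sphi 0 U0 1%nat) as Dphi. apply Derive_correct in Dphi.
  change (is_derive phi 0 (Derive phi 0)) in Dphi.
  set (l := Derive phi 0) in *.
  destruct (is_derive_bound phi 0 l Dphi 1 Rlt_0_1) as (d1 & Hd1 & B1).
  assert (Hlip : locally_2d (fun u v => ex_diff_n (fun x y => fst (Phi (x, y))) 1 u v)
    (fst (g c)) (snd (g c))).
  { apply locally_2d_locally. rewrite <- surjective_pairing.
    apply (filter_imp U'); [ | apply OU', Up]. intros p Hp. apply (SPhi p Hp 1%nat). }
  apply smooth2_lipschitz_at in Hlip. destruct Hlip as (D & HD & (d2 & B2)).
  set (K := Rabs l + 1). pose proof (Rabs_pos l) as Hl.
  assert (HK : 1 <= K) by (unfold K; lra).
  exists (K ^ 2 * D). split; [apply Rmult_le_pos; [nra | exact HD] | ]. intros d Hd.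
  assert (Hnear : forall f : R -> R, continuous f c ->
    exists d, 0 < d /\ forall u, Rabs (u - c) < d -> Rabs (f u - f c) < d2).
  { intros f Hf. apply continuity_pt_filterlim in Hf.
    destruct (Hf d2) as (r & Hr & B); [apply cond_pos | ]. exists r. split; [exact Hr | ].
    intros u Hu. destruct (Req_dec c u) as [<- | N].
    - rewrite Rminus_diag, Rabs_R0. apply cond_pos.
    - apply (B u). split; [split; [exact I | exact N] | exact Hu]. }
  destruct (Hnear _ C1) as (r1 & Hr1 & R1). destruct (Hnear _ C2) as (r2 & Hr2 & R2).
  destruct Heq as (d3 & B3).
  set (m := Rmin (Rmin d1 d3) (Rmin d (Rmin r1 r2))).
  assert (0 < m /\ m <= d1 /\ m <= d3 /\ m <= d /\ m <= r1 /\ m <= r2)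
    as (M0 & M1 & M2 & M3 & M4 & M5).
  { unfold m. pose proof (cond_pos d3).
    pose proof (Rmin_l (Rmin d1 d3) (Rmin d (Rmin r1 r2))).
    pose proof (Rmin_r (Rmin d1 d3) (Rmin d (Rmin r1 r2))).
    pose proof (Rmin_l d1 d3). pose proof (Rmin_r d1 d3).
    pose proof (Rmin_l d (Rmin r1 r2)). pose proof (Rmin_r d (Rmin r1 r2)).
    pose proof (Rmin_l r1 r2). pose proof (Rmin_r r1 r2).
    repeat split; try lra. repeat apply Rmin_glb_lt; lra. }
  (* [K] is a Lipschitz constant of [phi] at 0, so [phi t] is within [m] of [c]. *)
  set (t := m / (2 * K)).
  assert (Ht : 0 < t) by (apply Rdiv_lt_0_compat; lra).
  assert (HtK : K * t = m / 2) by (unfold t; field; lra).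
  assert (Htm : t < m) by nra.
  assert (Hut : Rabs (phi t - c) <= K * t).
  { specialize (B1 t). rewrite !Rminus_0_r, Ephi, (Rabs_pos_eq t) in B1 by lra.
    specialize (B1 ltac:(lra)).
    replace (phi t - c) with ((phi t - c - l * t) + l * t) by ring.
    apply Rle_trans with (1 := Rabs_triang _ _).
    rewrite (Rabs_mult l t), (Rabs_pos_eq t) by lra. unfold K. lra. }
  assert (Hum : Rabs (phi t - c) < m) by (apply Rle_lt_trans with (1 := Hut); lra).
  exists (phi t).
  assert (Eq0 : Phi (g c) = (0, 0)).
  { assert (E0 : Phi (g (phi 0)) = (0 ^ 2, 0 ^ 3)) by (apply B3; apply ball_center).
    rewrite Ephi in E0. rewrite E0. f_equal; ring. }
  assert (Eqt : Phi (g (phi t)) = (t ^ 2, t ^ 3)).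
  { apply B3. unfold ball; simpl. unfold AbsRing_ball, abs, minus, plus, opp; simpl.
    rewrite Ropp_0, Rplus_0_r, Rabs_pos_eq; lra. }
  split; [ | split; [lra | ]].
  - intros E. rewrite E, Eq0 in Eqt. injection Eqt. nra.
  - specialize (B2 (fst (g (phi t))) (snd (g (phi t)))
      (R1 _ (Rlt_le_trans _ _ _ Hum M4)) (R2 _ (Rlt_le_trans _ _ _ Hum M5))).
    cbv beta in B2. rewrite <- !surjective_pairing, Eq0, Eqt in B2. simpl fst in B2.
    rewrite Rminus_0_r, Rabs_pos_eq in B2 by nra.
    set (M := Rmax _ _) in *.
    rewrite <- (pow2_abs (phi t - c)).
    apply Rle_trans with ((K * t) ^ 2).
    + apply pow_incr. split; [apply Rabs_pos | exact Hut].
    + rewrite Rpow_mult_distr, Rmult_assoc. apply Rmult_le_compat_l; [nra | exact B2].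
Qed.

(** At a double zero of the speed the displacement would be [o((u - c)^2)], against
    the quadratic lower bound. *)
Lemma cusp_speed_simple_zero (g e : R -> R * R) (rho : R -> R) (c : R) :
  (forall t, is_derive (fun s => fst (g s)) t (rho t * fst (e t))) ->
  (forall t, is_derive (fun s => snd (g s)) t (rho t * snd (e t))) ->
  (forall t, Rabs (fst (e t)) <= 1 /\ Rabs (snd (e t)) <= 1) ->
  ex_derive rho c -> rho c = 0 -> is_cusp g c -> Derive rho c <> 0.
Proof.
  intros H1 H2 He Hr Z Hcusp Hd.
  destruct (cusp_quadratic_lower_bound g c Hcusp) as (C & HC & HB).
  { apply (ex_derive_continuous (fun t => fst (g t))). eexists; apply H1. }
  { apply (ex_derive_continuous (fun t => snd (g t))). eexists; apply H2. }
  apply Derive_correct in Hr. rewrite Hd in Hr.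
  (* Any [eps] with [C * eps < 1] contradicts the bound. *)
  set (eps := / (2 * (C + 1))).
  assert (Heps : 0 < eps) by (apply Rinv_0_lt_compat; lra).
  destruct (is_derive_bound rho c 0 Hr eps Heps) as (d & Hd0 & B).
  destruct (HB d Hd0) as (u & Hu & Hud & Hq).
  assert (Hcomp : forall (f k : R -> R), (forall t, is_derive f t (rho t * k t)) ->
    (forall t, Rabs (k t) <= 1) -> Rabs (f u - f c) <= eps * (u - c) ^ 2).
  { intros f k Hf Hk.
    destruct (MVT_gen f c u (fun t => rho t * k t)) as (w & Hw & E).
    - intros t _. apply Hf.
    - intros t _. apply continuity_pt_filterlim, (ex_derive_continuous f). eexists; apply Hf.
    - rewrite E.
      assert (Hwc : Rabs (w - c) <= Rabs (u - c)).
      { revert Hw. unfold Rmin, Rmax. destruct (Rle_dec c u); unfold Rabs;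
          destruct (Rcase_abs (w - c)), (Rcase_abs (u - c)); lra. }
      specialize (B w ltac:(lra)).
      rewrite Z, Rmult_0_l, !Rminus_0_r in B.
      rewrite !Rabs_mult, <- (pow2_abs (u - c)).
      pose proof (Hk w). pose proof (Rabs_pos (k w)). pose proof (Rabs_pos (rho w)).
      pose proof (Rabs_pos (u - c)). pose proof (Rabs_pos (w - c)).
      assert (Rabs (rho w) * Rabs (k w) <= eps * Rabs (u - c)).
      { apply Rle_trans with (Rabs (rho w) * 1); [apply Rmult_le_compat_l; assumption | ].
        rewrite Rmult_1_r. apply Rle_trans with (1 := B). apply Rmult_le_compat_l; lra. }
      nra. }
  assert (HM : Rmax (Rabs (fst (g u) - fst (g c))) (Rabs (snd (g u) - snd (g c)))
               <= eps * (u - c) ^ 2).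
  { apply Rmax_lub.
    - apply (Hcomp (fun t => fst (g t)) (fun t => fst (e t)) H1). intros t. apply He.
    - apply (Hcomp (fun t => snd (g t)) (fun t => snd (e t)) H2). intros t. apply He. }
  assert (Hsq : 0 < (u - c) ^ 2) by (apply pow2_gt_0; lra).
  assert (HCe : C * eps < 1).
  { unfold eps. apply Rmult_lt_reg_r with (2 * (C + 1)); [lra | ].
    rewrite Rmult_assoc, Rinv_l; lra. }
  assert (C * Rmax (Rabs (fst (g u) - fst (g c))) (Rabs (snd (g u) - snd (g c)))
          <= C * (eps * (u - c) ^ 2)) by (apply Rmult_le_compat_l; assumption).
  nra.
Qed.

(** * Fronts of total absolute curvature PI *)

Lemma enorm_one (v : R * R) : enorm v = 1 -> fst v ^ 2 + snd v ^ 2 = 1.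
Proof.
  unfold enorm. intros H.
  rewrite <- (sqrt_sqrt (fst v ^ 2 + snd v ^ 2)), H; [ring | ].
  pose proof (pow2_ge_0 (fst v)). pose proof (pow2_ge_0 (snd v)). lra.
Qed.

Lemma parallel_to_unit (v e : R * R) :
  enorm e = 1 -> lin_dep v e ->
  fst v = (fst v * fst e + snd v * snd e) * fst e /\
  snd v = (fst v * fst e + snd v * snd e) * snd e.
Proof.
  intros He (a & b & Hab & H1 & H2). apply enorm_one in He.
  destruct v as [v1 v2], e as [e1 e2]; cbn [fst snd] in *.
  assert (Ha : a <> 0).
  { intros ->. apply Hab. f_equal.
    transitivity (b * (e1 ^ 2 + e2 ^ 2)); [rewrite He; ring | ].
    transitivity ((0 * v1 + b * e1) * e1 + (0 * v2 + b * e2) * e2); [ring | ].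
    rewrite H1, H2. ring. }
  assert (E1 : v1 = - (b / a) * e1) by (apply Rmult_eq_reg_l with a; [field_simplify; lra | exact Ha]).
  assert (E2 : v2 = - (b / a) * e2) by (apply Rmult_eq_reg_l with a; [field_simplify; lra | exact Ha]).
  assert (E : v1 * e1 + v2 * e2 = - (b / a)).
  { rewrite E1, E2. transitivity (- (b / a) * (e1 ^ 2 + e2 ^ 2)); [ring | rewrite He; ring]. }
  rewrite E. auto.
Qed.

Lemma smooth_derivable (f : R -> R) :
  smooth_on (fun _ => True) f -> (forall t, ex_derive f t) /\ (forall t, ex_derive (Derive f) t).
Proof. intros H. split; intros t; [exact (H t I 1%nat) | exact (H t I 2%nat)]. Qed.

Lemma cos_minus_one_angle (d : R) : - PI <= d <= PI -> cos d = -1 -> Rabs d = PI.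
Proof.
  intros Hd Hc. pose proof (Rabs_pos d).
  assert (Hle : Rabs d <= PI) by (apply Rabs_le; lra).
  destruct (Rle_lt_or_eq_dec _ _ Hle) as [L | E]; [exfalso | exact E].
  assert (Hca : cos (Rabs d) = -1).
  { unfold Rabs. destruct (Rcase_abs d); [rewrite cos_neg | ]; exact Hc. }
  assert (cos PI < cos (Rabs d)) by (apply cos_decreasing_1; lra).
  rewrite cos_PI in *. lra.
Qed.

(** An antiperiodic unit field turns over a period by an odd multiple of [PI], and
    the total absolute curvature bounds the turning by [PI]: the angle is monotone.
    The factor [k] reflects the plane when the front turns clockwise. *)
Lemma front_half_turn (g e : R -> R * R) :
  is_closed_front g e -> non_co_orientable e -> total_absolute_curvature e = PI ->
  (forall t : R, singular g t -> is_cusp g t) ->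
  exists k rho th, (k = 1 \/ k = -1) /\ (forall t, singular g t <-> rho t = 0) /\
    half_turn_front (fun t => fst (g t)) (fun t => k * snd (g t)) rho th.
Proof.
  intros [[[[Sg1 Sg2] _] [[[Se1 Se2] [Hunit Hdep]] Hfront]] Hper] Hnco HK Hcusp.
  pose proof PI_RGT_0 as HPI.
  set (g1 := fun t => fst (g t)) in *. set (g2 := fun t => snd (g t)) in *.
  set (a := fun t => fst (e t)) in *. set (b := fun t => snd (e t)) in *.
  destruct (smooth_derivable g1 Sg1) as [Dg1 DDg1].
  destruct (smooth_derivable g2 Sg2) as [Dg2 DDg2].
  destruct (smooth_derivable a Se1) as [Da DDa].
  destruct (smooth_derivable b Se2) as [Db DDb].
  assert (H1 : forall t, a t ^ 2 + b t ^ 2 = 1) by (intros t; apply enorm_one, Hunit).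
  set (rho := fun t => Derive g1 t * a t + Derive g2 t * b t).
  assert (Hrho : forall t, Derive g1 t = rho t * a t /\ Derive g2 t = rho t * b t).
  { intros t. exact (parallel_to_unit _ _ (Hunit t) (Hdep t)). }
  assert (Dg1' : forall t, is_derive g1 t (rho t * a t)).
  { intros t. rewrite <- (proj1 (Hrho t)). apply Derive_correct, Dg1. }
  assert (Dg2' : forall t, is_derive g2 t (rho t * b t)).
  { intros t. rewrite <- (proj2 (Hrho t)). apply Derive_correct, Dg2. }
  assert (Hsing : forall t, singular g t <-> rho t = 0).
  { intros t. unfold singular, velocity. fold g1 g2. split.
    - intros E. injection E as E1 E2. unfold rho. rewrite E1, E2. ring.
    - intros Z. rewrite (proj1 (Hrho t)), (proj2 (Hrho t)), Z. f_equal; ring. }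
  assert (Drho : forall t, ex_derive rho t).
  { intros t. apply (ex_derive_plus (fun t => Derive g1 t * a t) (fun t => Derive g2 t * b t)).
    - apply (ex_derive_mult (Derive g1) a); [apply DDg1 | apply Da].
    - apply (ex_derive_mult (Derive g2) b); [apply DDg2 | apply Db]. }
  assert (Hsimple : simple_zeros rho).
  { intros c Z. apply (cusp_speed_simple_zero g e rho c Dg1' Dg2'); [ | apply Drho | exact Z | ].
    - intros t. specialize (H1 t). unfold a, b in H1.
      split; apply Rabs_le; nra.
    - apply Hcusp, Hsing, Z. }
  destruct (unit_field_angle a b Da Db (fun t => ex_derive_continuous _ t (DDa t))
    (fun t => ex_derive_continuous _ t (DDb t)) H1) as (th & Hth & Hang).
  set (kap := fun t => a t * Derive b t - b t * Derive a t) in *.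
  assert (Ea : forall t, a (t + 2 * PI) = -1 * a t).
  { intros t. unfold a. rewrite Hnco. simpl. ring. }
  assert (Eb : forall t, b (t + 2 * PI) = -1 * b t).
  { intros t. unfold b. rewrite Hnco. simpl. ring. }
  assert (Eg1 : forall t, g1 (t + 2 * PI) = 1 * g1 t).
  { intros t. unfold g1. rewrite Hper. ring. }
  assert (Eg2 : forall t, g2 (t + 2 * PI) = 1 * g2 t).
  { intros t. unfold g2. rewrite Hper. ring. }
  assert (Hkper : forall t, kap (t + 2 * PI) = kap t).
  { intros t. unfold kap.
    rewrite (Derive_shift a _ _ t Da Ea), (Derive_shift b _ _ t Db Eb), Ea, Eb. ring. }
  assert (Hrper : forall t, rho (t + 2 * PI) = - rho t).
  { intros t. unfold rho.
    rewrite (Derive_shift g1 _ _ t Dg1 Eg1), (Derive_shift g2 _ _ t Dg2 Eg2), Ea, Eb. ring. }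
  assert (Ck : forall t, continuous kap t).
  { intros t. unfold kap.
    apply (continuous_minus (fun t => a t * Derive b t) (fun t => b t * Derive a t)).
    - apply (continuous_mult a (Derive b)).
      + apply (ex_derive_continuous a t (Da t)).
      + apply (ex_derive_continuous (Derive b) t (DDb t)).
    - apply (continuous_mult b (Derive a)).
      + apply (ex_derive_continuous b t (Db t)).
      + apply (ex_derive_continuous (Derive a) t (DDa t)). }
  assert (Hvel : forall t, Derive a t = - (kap t * b t) /\ Derive b t = kap t * a t).
  { intros t. destruct (Hang t) as [A B]. rewrite A, B. split.
    - rewrite (Derive_ext a (fun s => cos (th s))) by (intros s; apply Hang).
      apply is_derive_unique. replace (- (kap t * sin (th t))) with (kap t * - sin (th t)) by ring.
      apply (is_derive_comp cos th); [apply is_derive_cos | apply Hth].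
    - rewrite (Derive_ext b (fun s => sin (th s))) by (intros s; apply Hang).
      apply is_derive_unique. apply (is_derive_comp sin th); [apply is_derive_sin | apply Hth]. }
  assert (HKk : RInt (fun t => Rabs (kap t)) 0 (2 * PI) = PI).
  { transitivity (total_absolute_curvature e); [ | exact HK].
    unfold total_absolute_curvature. apply RInt_ext. intros t _.
    unfold enorm, velocity. fold a b. simpl fst. simpl snd.
    rewrite (proj1 (Hvel t)), (proj2 (Hvel t)), <- sqrt_Rsqr_abs. f_equal. unfold Rsqr.
    transitivity (kap t * kap t * (a t ^ 2 + b t ^ 2)); [rewrite H1; ring | ring]. }
  set (T := th (2 * PI) - th 0).
  assert (HT : RInt kap 0 (2 * PI) = T).
  { apply is_RInt_unique, (is_RInt_derive th kap); intros; [apply Hth | apply Ck]. }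
  assert (Hint : forall (f : R -> R) u v, (forall t, continuous f t) -> ex_RInt f u v).
  { intros f u v Hf. apply (ex_RInt_continuous f). intros z _. apply Hf. }
  assert (HTabs : Rabs T = PI).
  { assert (HTle : Rabs T <= PI).
    { rewrite <- HKk, <- HT. apply abs_RInt_le; [lra | apply Hint, Ck]. }
    apply cos_minus_one_angle.
    - apply Rabs_le_between, HTle.
    - unfold T. rewrite cos_minus.
      destruct (Hang 0) as [A0 B0], (Hang (2 * PI)) as [A2 B2]. rewrite <- A0, <- B0, <- A2, <- B2.
      pose proof (Ea 0) as Ea0. pose proof (Eb 0) as Eb0. rewrite Rplus_0_l in Ea0, Eb0.
      rewrite Ea0, Eb0. transitivity (- (a 0 ^ 2 + b 0 ^ 2)); [ring | rewrite H1; ring]. }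
  assert (Hk : exists k, (k = 1 \/ k = -1) /\ k * T = PI).
  { revert HTabs. unfold Rabs. destruct (Rcase_abs T); [exists (-1) | exists 1]; split; auto; lra. }
  destruct Hk as (k & Hk & HkT).
  assert (Habsk : Rabs k = 1)
    by (destruct Hk as [-> | ->]; [apply Rabs_R1 | rewrite Rabs_left; lra]).
  assert (Ckk : forall t, continuous (fun t => k * kap t) t).
  { intros t. apply (continuous_scal_r k kap t (Ck t)). }
  assert (Hkpos : forall t, 0 <= k * kap t).
  { assert (Hopen : forall t, 0 < t < 2 * PI -> 0 <= k * kap t).
    { apply (curvature_sign (fun t => k * kap t) (2 * PI)); [lra | exact Ckk | ].
      rewrite (RInt_ext (fun t => Rabs (k * kap t)) (fun t => Rabs (kap t))).
      - transitivity (k * RInt kap 0 (2 * PI)).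
        + apply (RInt_scal kap 0 (2 * PI) k). apply Hint, Ck.
        + rewrite HT, HKk. exact HkT.
      - intros t _. rewrite Rabs_mult, Habsk. apply Rmult_1_l. }
    (* Continuity gives the endpoint, periodicity the rest of the line. *)
    assert (Hcl : forall s, in_period s -> 0 <= k * kap s).
    { intros s Hs. unfold in_period in Hs. destruct (Req_dec s 0) as [-> | N]; [ | apply Hopen; lra].
      apply Rnot_lt_le. intros Hneg.
      pose proof (Ckk 0) as C0. apply continuity_pt_filterlim in C0.
      destruct (C0 (- (k * kap 0))) as (d & Hd & B); [lra | ].
      set (m := Rmin d PI / 2).
      assert (Hm : 0 < m < d /\ m < 2 * PI).
      { unfold m. pose proof (Rmin_l d PI). pose proof (Rmin_r d PI).
        assert (0 < Rmin d PI) by (apply Rmin_glb_lt; lra). lra. }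
      specialize (B m). simpl in B. unfold R_dist in B.
      assert (Hb : Rabs (k * kap m - k * kap 0) < - (k * kap 0)).
      { apply B. split; [split; [exact I | lra] | ]. rewrite Rminus_0_r, Rabs_pos_eq; lra. }
      apply Rabs_def2 in Hb. specialize (Hopen m ltac:(lra)). lra. }
    intros t. destruct (period_representative t) as (m & s & Hs & ->).
    rewrite (periodic_Z kap Hkper). apply Hcl, Hs. }
  assert (Dth : forall t, is_derive (fun t => k * th t) t (k * kap t)).
  { intros t. apply (is_derive_scal th). apply Hth. }
  assert (Hmono : forall s t, s <= t -> k * th s <= k * th t).
  { intros s t Hst. apply (derive_nonneg_incr (fun t => k * th t) (fun t => k * kap t) s t Hst Dth).
    intros u _. apply Hkpos. }
  assert (Hstrict : forall c, rho c = 0 -> 0 < k * kap c).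
  { intros c Z. destruct (Hkpos c) as [L | E]; [exact L | exfalso].
    assert (Hk0 : kap c = 0) by (destruct Hk as [-> | ->]; lra).
    apply (Hfront c). split; [apply Hsing, Z | ].
    unfold velocity. fold a b. rewrite (proj1 (Hvel c)), (proj2 (Hvel c)), Hk0. f_equal; ring. }
  exists k, rho, (fun t => k * th t). split; [exact Hk | split; [exact Hsing | ]].
  assert (Hcs : forall t, cos (k * th t) = a t /\ sin (k * th t) = k * b t).
  { intros t. destruct (Hang t) as [A B]. destruct Hk as [-> | ->].
    - rewrite !Rmult_1_l. auto.
    - replace (-1 * th t) with (- th t) by ring. rewrite cos_neg, sin_neg, A, B. split; ring. }
  constructor.
  - intros t. rewrite (proj1 (Hcs t)). apply Dg1'.
  - intros t. rewrite (proj2 (Hcs t)). replace (rho t * (k * b t)) with (k * (rho t * b t)) by ring.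
    apply (is_derive_scal g2). apply Dg2'.
  - intros t. rewrite Eg1. apply Rmult_1_l.
  - intros t. unfold g2. now rewrite Hper.
  - exact Drho.
  - exact Hsimple.
  - exact Hrper.
  - apply ex_derive_continuity. intros t. eexists. apply Dth.
  - exact Hmono.
  - intros c t Z Htc.
    destruct (is_derive_pos_local _ c _ (Dth c) (Hstrict c Z)) as (d & Hd & _ & Hl).
    set (u := Rmax t (c - d / 2)).
    assert (Hu : t <= u < c /\ c - d < u).
    { unfold u. split; [split; [apply Rmax_l | apply Rmax_lub_lt; lra] | ].
      pose proof (Rmax_r t (c - d / 2)). lra. }
    specialize (Hl u ltac:(lra)). pose proof (Hmono t u ltac:(lra)). lra.
  - intros c t Z Htc.
    destruct (is_derive_pos_local _ c _ (Dth c) (Hstrict c Z)) as (d & Hd & Hr & _).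
    set (u := Rmin t (c + d / 2)).
    assert (Hu : c < u <= t /\ u < c + d).
    { unfold u. split; [split; [apply Rmin_glb_lt; lra | apply Rmin_l] | ].
      pose proof (Rmin_r t (c + d / 2)). lra. }
    specialize (Hr u ltac:(lra)). pose proof (Hmono u t ltac:(lra)). lra.
  - intros t.
    assert (Hd0 : forall s, is_derive (fun s => k * th (s + 2 * PI) - k * th s) s 0).
    { intros s. replace 0 with (minus (k * kap s) (k * kap s))
        by (unfold minus, plus, opp; simpl; ring).
      apply (is_derive_minus (fun s => k * th (s + 2 * PI)) (fun s => k * th s)); [ | apply Dth].
      apply (is_derive_scal (fun s => th (s + 2 * PI))).
      replace (kap s) with (1 * kap (s + 2 * PI)) by (rewrite Hkper; ring).
      apply (is_derive_comp th (fun s => s + 2 * PI)); [apply Hth | ].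
      auto_derive; [exact I | ring]. }
    pose proof (constant_of_derive_zero _ Hd0 t 0) as E. cbv beta in E.
    rewrite Rplus_0_l in E. unfold T in HkT. lra.
Qed.

Theorem theorem2 (g e : R -> R * R)
    (hfront : is_closed_front g e)
    (hnco : non_co_orientable e)
    (hK : total_absolute_curvature e = PI)
    (hcusp : forall t : R, singular g t -> is_cusp g t) :
  exists N : nat,
    has_card (fun t => in_period t /\ singular g t) N /\
    Nat.Odd N /\ (3 <= N)%nat /\
    (N = 3%nat <-> simple_closed g).
Proof.
  destruct (front_half_turn g e hfront hnco hK hcusp) as (k & rho & th & Hk & Hsing & F).
  destruct (half_turn_front_cusps _ _ _ _ F) as (N & (l & Hl & HN & Hin) & Hodd & H3 & Hsimple).
  exists N. split; [ | split; [exact Hodd | split; [exact H3 | ]]].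
  - exists l. split; [exact Hl | split; [exact HN | ]].
    intros t. rewrite Hin, Hsing. reflexivity.
  - rewrite Hsimple. unfold simple_closed. split; intros H s t Hs Ht.
    + intros E. apply H; [exact Hs | exact Ht | | ]; now rewrite E.
    + intros E1 E2. apply H; [exact Hs | exact Ht | ].
      rewrite (surjective_pairing (g s)), (surjective_pairing (g t)). f_equal; [exact E1 | ].
      destruct Hk as [-> | ->]; lra.
Qed.
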